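(* Let $\mathbf{k}$ be a commutative ring with $1$, $V=\mathbf{k}^n$, $S=\mathbf{k}[x_1,\ldots,x_n]=S(V)$. Fix integers $d,r\ge 1$, and let $R=S^{(d)}$ and $M=S^{(\geq r,d)}$. Then there is an explicit $GL(V)$-equivariant minimal $R$-free resolution of $M$ of the form $$0\leftarrow M\leftarrow R\otimes_{\mathbf{k}}\mathbb{S}^{(r)}(V)\leftarrow R\otimes_{\mathbf{k}}\mathbb{S}^{\sigma(d,r)}(V)\leftarrow R\otimes_{\mathbf{k}}\mathbb{S}^{\sigma(d,d,r)}(V)\leftarrow R\otimes_{\mathbf{k}}\mathbb{S}^{\sigma(d,d,d,r)}(V)\leftarrow\cdots$$ whose $i$th term $R\otimes_{\mathbf{k}}\mathbb{S}^{\sigma(d^i,r)}(V)$ has its $R$-basis elements in degree $di+r$, for $i=0,1,2,\ldots$.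
   Context: Let $x_1,\ldots,x_n$ be the $\mathbf{k}$-basis of $V$. $S=\bigoplus_j S_j$ has the standard grading, with $S_j=S^j(V)$ the $j$th symmetric power, and $GL(V)\cong GL_n(\mathbf{k})$ acts on $S$ by $\mathbf{k}$-algebra automorphisms extending its action on $V$. The $d$th Veronese subalgebra is $S^{(d)}=\bigoplus_{j\equiv 0 \bmod d}S_j$, and $S^{(\geq r,d)}=\bigoplus_{j\ge r,\ j\equiv r \bmod d}S_j$, an $S^{(d)}$-submodule of $S$. Gradings are those inherited from $S$. ''Minimal'' means that all matrix entries of the differentials lie in $R_+=S^{(\geq d,d)}=\bigoplus_{j\geq 1} R_j$. ''$GL(V)$-equivariant'' means that all maps are $R$-linear and commute with $GL(V)$, acting diagonally on $R\otimes_{\mathbf{k}}\mathbb{S}^{D}(V)$. Schur functors: for a finite diagram $D$ of cells (matrix-style coordinates, rows listed bottom-to-top $R_1,\dots,R_p$, columns listed left-to-right $C_1,\dots,C_c$), $\mathbb{S}^D(V)$ is the $GL(V)$-submodule of $S^{|R_1|}(V)\otimes_{\mathbf{k}}\cdots\otimes_{\mathbf{k}} S^{|R_p|}(V)$ that is the image of the composite $$\wedge^{|C_1|}(V)\otimes\cdots\otimes\wedge^{|C_c|}(V)\to V^{\otimes |D|}\to S^{|R_1|}(V)\otimes\cdots\otimes S^{|R_p|}(V),$$ where tensor positions of $V^{\otimes|D|}$ are indexed by cells of $D$, the first map is the tensor product over columns of the antisymmetrizations $v_1\wedge\cdots\wedge v_\ell\mapsto\sum_{w\in\mathfrak{S}_\ell}\operatorname{sgn}(w)\,v_{w(1)}\otimes\cdots\otimes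 v_{w(\ell)}$ (placed in the cells of that column from top to bottom), and the second map multiplies together the entries in each row. Ribbons: for a composition (sequence of positive integers) $\alpha=(\alpha_1,\ldots,\alpha_\ell)$, $\sigma(\alpha)$ is the ribbon skew diagram whose row sizes from bottom to top are $\alpha_1,\ldots,\alpha_\ell$, each row's rightmost cell lying in the same column as the leftmost cell of the row just above it, and no other column overlaps. $(d^i,r)$ denotes $(d,\ldots,d,r)$ with $i$ copies of $d$, so $\mathbb{S}^{\sigma(r)}(V)=\mathbb{S}^{(r)}(V)=S^r(V)$. *)

(* Defs.v *)
From HB Require Import structures.
From mathcomp Require Import all_boot all_order all_fingroup all_algebra.
From mathcomp Require Import generic_quotient ring_quotient finmap.
From mathcomp.classical Require Import boolp.
From mathcomp Require Import freeg mpoly.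

Set Implicit Arguments.
Unset Strict Implicit.
Unset Printing Implicit Defensive.

Import GRing.Theory.

Local Open Scope ring_scope.

Section Span.
Variables (A : nzRingType) (M : lmodType A).

Inductive lspan (G : M -> Prop) : M -> Prop :=
| lspan0 : lspan G 0
| lspan_cons c u v : G u -> lspan G v -> lspan G (c *: u + v).

Lemma lspanD (G : M -> Prop) c u v :
  lspan G u -> lspan G v -> lspan G (c *: u + v).
Proof.
move=> Gu Gv; elim: Gu => [|b x y Gx _ IH]; first by rewrite scaler0 add0r.
by rewrite scalerDr scalerA -addrA; apply: lspan_cons.
Qed.

Lemma lspan_gen (G : M -> Prop) u : G u -> lspan G u.
Proof.
by move=> Gu; rewrite -[u]addr0 -[u]scale1r; apply: lspan_cons => //; left.
Qed.

Definition is_basis (m : nat) (b : 'I_m -> M) : Prop :=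
  forall x : M, exists! c : {ffun 'I_m -> A}, x = \sum_l c l *: b l.

End Span.

Section Tensor.
Variables (k : comNzRingType) (M N : lmodType k).
Local Notation free := {freeg (M * N)%type / k}.

Inductive tens_rel : free -> Prop :=
| TensDl a b y : tens_rel (<< (a + b, y) >> - << (a, y) >> - << (b, y) >>)
| TensDr a x y : tens_rel (<< (a, x + y) >> - << (a, x) >> - << (a, y) >>)
| TensZl c a y : tens_rel (<< (c *: a, y) >> - c *: << (a, y) >>)
| TensZr c a y : tens_rel (<< (a, c *: y) >> - c *: << (a, y) >>).

Definition tens_ker : {pred free} := fun u => `[< lspan tens_rel u >].

Lemma tens_ker_closed : submod_closed tens_ker.
Proof.
split=> [|c u v]; first by apply/asboolP; left.
by move=> /asboolP hu /asboolP hv; apply/asboolP; apply: lspanD.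
Qed.

HB.instance Definition _ :=
  GRing.isSubmodClosed.Build k free tens_ker tens_ker_closed.

Definition tensor := Quotient.quot tens_ker.
HB.instance Definition _ := GRing.Zmodule.on tensor.

Definition tpi (u : free) : tensor := \pi_(Quotient.quot tens_ker)%qT u.

Lemma tpi_eq u v : (tpi u = tpi v) <-> lspan tens_rel (u - v).
Proof.
split=> [/eqP|h]; first by rewrite -Quotient.idealrBE => /asboolP.
by apply/eqP; rewrite -Quotient.idealrBE; apply/asboolP.
Qed.

Lemma tpiD u v : tpi (u + v) = tpi u + tpi v.
Proof. exact: (raddfD \pi_(Quotient.quot tens_ker)%qT). Qed.

Definition tens_scale (c : k) (x : tensor) : tensor :=
  tpi (c *: generic_quotient.repr x).

Lemma tpi_repr x : tpi (generic_quotient.repr x) = x.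
Proof. exact: reprK. Qed.

Lemma tens_scaleE c u : tens_scale c (tpi u) = tpi (c *: u).
Proof.
apply/tpi_eq; rewrite -scalerBr -[_ *: _]addr0.
by apply: lspanD; [apply/tpi_eq; rewrite tpi_repr | left].
Qed.

Fact tens_scaleA a b x : tens_scale a (tens_scale b x) = tens_scale (a * b) x.
Proof. by rewrite -[x]tpi_repr !tens_scaleE scalerA. Qed.

Fact tens_scale1 : left_id 1 tens_scale.
Proof. by move=> x; rewrite -[x]tpi_repr !tens_scaleE scale1r. Qed.

Fact tens_scaleDr : right_distributive tens_scale +%R.
Proof.
move=> c x y; rewrite -[x]tpi_repr -[y]tpi_repr -tpiD !tens_scaleE.
by rewrite scalerDr tpiD.
Qed.

Fact tens_scaleDl x : {morph tens_scale^~ x : a b / a + b}.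
Proof. by move=> a b; rewrite -[x]tpi_repr !tens_scaleE scalerDl tpiD. Qed.

HB.instance Definition _ := GRing.Zmodule_isLmodule.Build k tensor
  tens_scaleA tens_scale1 tens_scaleDr tens_scaleDl.

Definition tens (a : M) (y : N) : tensor := tpi << (a, y) >>.

End Tensor.

Arguments tens {k M N}.
Arguments tpi {k M N}.

Section TensorTheory.
Variables (k : comNzRingType) (M N : lmodType k).
Local Notation free := {freeg (M * N)%type / k}.

Lemma tpiZ c (u : free) : tpi (c *: u) = c *: tpi u.
Proof. by rewrite -tens_scaleE. Qed.

Fact tpi_is_linear : linear (@tpi k M N).
Proof. by move=> c u v; rewrite tpiD tpiZ. Qed.

HB.instance Definition _ :=
  GRing.isLinear.Build k free (tensor M N) _ (@tpi k M N) tpi_is_linear.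

Lemma tpi_rel (u : free) : tens_rel u -> tpi u = 0.
Proof.
by move=> hu; rewrite -(linear0 (@tpi k M N)); apply/tpi_eq;
  rewrite subr0; apply: lspan_gen.
Qed.

Lemma tensDl (a b : M) (y : N) : tens (a + b) y = tens a y + tens b y.
Proof.
have /eqP := tpi_rel (TensDl a b y).
by rewrite !raddfB /= -addrA -opprD subr_eq0 => /eqP.
Qed.

Lemma tensDr (a : M) (x y : N) : tens a (x + y) = tens a x + tens a y.
Proof.
have /eqP := tpi_rel (TensDr a x y).
by rewrite !raddfB /= -addrA -opprD subr_eq0 => /eqP.
Qed.

Lemma tensZl c (a : M) (y : N) : tens (c *: a) y = c *: tens a y.
Proof.
by have /eqP := tpi_rel (TensZl c a y); rewrite raddfB /= tpiZ subr_eq0 => /eqP.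
Qed.

Lemma tensZr c (a : M) (y : N) : tens a (c *: y) = c *: tens a y.
Proof.
by have /eqP := tpi_rel (TensZr c a y); rewrite raddfB /= tpiZ subr_eq0 => /eqP.
Qed.

Lemma tens_span (x : tensor M N) :
  lspan (fun z => exists a y, z = tens a y) x.
Proof.
rewrite -[x]tpi_repr; elim/freeg_ind_dom0: (generic_quotient.repr x).
  by rewrite linear0; left.
move=> c [a y] u _ _ IH; rewrite raddfD /=.
have -> : << c *g (a, y) >> = c *: << (a, y) >> :> free.
  by apply/eqP/freeg_eqP => z; rewrite coeffZ !coeffU mul1r.
by rewrite tpiZ; right => //; exists a, y.
Qed.

Lemma tens_ind (Q : tensor M N -> Prop) :
  Q 0 -> (forall a y u, Q u -> Q (tens a y + u)) -> forall x, Q x.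
Proof.
move=> Q0 QD x; elim: (tens_span x) => // c u v [a [y ->]] _.
by rewrite -tensZl; apply: QD.
Qed.

Section Lift.
Variables (P : lmodType k) (f : M -> N -> P).

Definition bilinear_map : Prop :=
  (forall y, linear (f^~ y)) /\ (forall a, linear (f a)).

Definition free_lift : free -> P := fglift (fun z => f z.1 z.2).

Fact free_lift_linear : linear free_lift.
Proof.
have fB : zmod_morphism free_lift by apply: lift_is_additive.
have f0 : free_lift 0 = 0 by rewrite -[0 in LHS](subrr 0) fB subrr.
have fN u : free_lift (- u) = - free_lift u by rewrite -sub0r fB f0 sub0r.
have fD u v : free_lift (u + v) = free_lift u + free_lift v.
  by rewrite -[v in LHS]opprK fB fN opprK.
move=> c u v; rewrite fD; congr (_ + _).
elim/freeg_ind_dom0: u => [|e x u _ _ IH]; first by rewrite scaler0 f0 scaler0.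
rewrite scalerDr !fD IH scalerDr; congr (_ + _).
have -> : c *: << e *g x >> = << c * e *g x >> :> free.
  by apply/eqP/freeg_eqP => z; rewrite coeffZ !coeffU mulrA.
by rewrite /free_lift !liftU scalerA.
Qed.

HB.instance Definition _ :=
  GRing.isLinear.Build k free P _ free_lift free_lift_linear.

Definition tens_lift (x : tensor M N) : P :=
  free_lift (generic_quotient.repr x).

Lemma tens_lift_pi (u : free) :
  bilinear_map -> tens_lift (tpi u) = free_lift u.
Proof.
case=> fl fr; apply/eqP; rewrite -subr_eq0 -raddfB; apply/eqP.
have : lspan (@tens_rel k M N) (generic_quotient.repr (tpi u) - u).
  by apply/tpi_eq; rewrite tpi_repr.
have U (z : M * N) : free_lift << z >> = f z.1 z.2.
  by rewrite /free_lift liftU scale1r.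
have fDl a b y : f (a + b) y = f a y + f b y.
  by have := fl y 1 a b; rewrite !scale1r.
have fDr a x y : f a (x + y) = f a x + f a y.
  by have := fr a 1 x y; rewrite !scale1r.
have f0l y : f 0 y = 0 by apply: (@addrI _ (f 0 y)); rewrite -fDl !addr0.
have f0r a : f a 0 = 0 by apply: (@addrI _ (f a 0)); rewrite -fDr !addr0.
have fZ e u' : free_lift (e *: u') = e *: free_lift u'.
  by have := free_lift_linear e u' 0; rewrite addr0 raddf0 addr0.
elim=> [|c w v hw _ IH]; first by rewrite raddf0.
rewrite raddfD /= IH addr0 fZ; suff -> : free_lift w = 0 by rewrite scaler0.
case: hw => [a b y|a x y|e a y|e a y]; rewrite !raddfB /= ?fZ !U /=.
- by rewrite fDl addrAC addrK subrr.
- by rewrite fDr addrAC addrK subrr.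
- by have := fl y e a 0; rewrite addr0 f0l addr0 => ->; rewrite subrr.
- by have := fr a e y 0; rewrite addr0 f0r addr0 => ->; rewrite subrr.
Qed.

Lemma tens_liftE (a : M) (y : N) :
  bilinear_map -> tens_lift (tens a y) = f a y.
Proof. by move=> /tens_lift_pi ->; rewrite /free_lift liftU scale1r. Qed.

Lemma tens_lift_linear : bilinear_map -> linear tens_lift.
Proof.
move=> fb c x y; rewrite -[x]tpi_repr -[y]tpi_repr -tpiZ -tpiD.
by rewrite !tens_lift_pi // linearP.
Qed.

End Lift.
End TensorTheory.

Section TensorMap.
Variables (k : comNzRingType) (M N M' N' : lmodType k).
Variables (f : {linear M -> M'}) (g : {linear N -> N'}).

Definition tens_map : tensor M N -> tensor M' N' :=
  tens_lift (fun a y => tens (f a) (g y)).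

Fact tens_map_bilinear : bilinear_map (fun a y => tens (f a) (g y)).
Proof.
split=> [y c a b|a c x y]; first by rewrite linearP tensDl tensZl.
by rewrite linearP tensDr tensZr.
Qed.

Fact tens_map_linear : linear tens_map.
Proof. exact: tens_lift_linear tens_map_bilinear. Qed.

HB.instance Definition _ := GRing.isLinear.Build k _ _ _ tens_map
  tens_map_linear.

Lemma tens_mapE a y : tens_map (tens a y) = tens (f a) (g y).
Proof. exact: tens_liftE tens_map_bilinear. Qed.

End TensorMap.

(* Scalars act on the left factor: a *: (b (x) y) = (a b) (x) y.  This is an
   alias of [tensor A N], which already carries its [lmodType k] structure. *)
Section BaseChange.
Variables (k : comNzRingType) (A : algType k) (N : lmodType k).

Definition base_change := tensor A N.
HB.instance Definition _ := GRing.Zmodule.on base_change.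

Definition bc_scale (a : A) (x : base_change) : base_change :=
  tens_lift (fun b y => tens (a * b) y) x.

Fact bc_scale_bilinear a :
  bilinear_map (fun b y => tens (a * b) y : tensor A N).
Proof.
split=> [y c b b'|b c x y]; last by rewrite tensDr tensZr.
by rewrite mulrDr -scalerAr tensDl tensZl.
Qed.

Lemma bc_scale_tens a b (y : N) : bc_scale a (tens b y) = tens (a * b) y.
Proof. exact: (tens_liftE _ _ (bc_scale_bilinear a)). Qed.

Fact bc_scaleDr : right_distributive bc_scale +%R.
Proof.
move=> a x y; have := tens_lift_linear (bc_scale_bilinear a) 1 x y.
by rewrite !scale1r.
Qed.

Lemma bc_scale0 a : bc_scale a 0 = 0.
Proof. by apply: (@addrI _ (bc_scale a 0)); rewrite -bc_scaleDr !addr0. Qed.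

Fact bc_scaleA a b x : bc_scale a (bc_scale b x) = bc_scale (a * b) x.
Proof.
elim/tens_ind: x => [|c y u IH]; first by rewrite !bc_scale0.
by rewrite !bc_scaleDr IH !bc_scale_tens mulrA.
Qed.

Fact bc_scale1 : left_id 1 bc_scale.
Proof.
elim/tens_ind => [|c y u IH]; first by rewrite bc_scale0.
by rewrite bc_scaleDr IH bc_scale_tens mul1r.
Qed.

Fact bc_scaleDl x : {morph bc_scale^~ x : a b / a + b}.
Proof.
move=> a b; elim/tens_ind: x => [|c y u IH]; first by rewrite !bc_scale0 addr0.
by rewrite !bc_scaleDr IH !bc_scale_tens mulrDl tensDl addrACA.
Qed.

HB.instance Definition _ := GRing.Zmodule_isLmodule.Build A base_change
  bc_scaleA bc_scale1 bc_scaleDr bc_scaleDl.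

End BaseChange.

Section Polynomials.
Variables (k : comNzRingType) (n : nat).
Local Notation S := {mpoly k[n]}.

(* \bigoplus_(j in J) S_j *)
Definition deg_in (J : pred nat) : {pred S} :=
  fun p => all (fun m => J (mdeg m)) (msupp p).

Definition lin_form (v : 'cV[k]_n) : S := \sum_i v i 0 *: 'X_i.

(* The k-algebra endomorphism x_i |-> \sum_j g j i *: x_j extending the action
   of the matrix g on V = k^n by column vectors. *)
Definition gl_sym (g : 'M[k]_n) (p : S) : S :=
  p \mPo [tuple lin_form (col i g) | i < n].

HB.instance Definition _ g := GRing.Linear.copy (gl_sym g)
  (comp_mpoly [tuple lin_form (col i g) | i < n]).
HB.instance Definition _ g := GRing.RMorphism.copy (gl_sym g)
  (comp_mpoly [tuple lin_form (col i g) | i < n]).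

Lemma deg_inP (J : pred nat) (p : S) :
  reflect {in msupp p, forall m, J (mdeg m)} (p \in deg_in J).
Proof. exact: allP. Qed.

Fact deg_in_closed (J : pred nat) : submod_closed (deg_in J).
Proof.
split=> [|c p q]; first by apply/deg_inP => m; rewrite msupp0.
move=> /deg_inP hp /deg_inP hq; apply/deg_inP => m /msuppD_le.
by rewrite mem_cat => /orP[/msuppZ_le/hp|/hq].
Qed.

HB.instance Definition _ J :=
  GRing.isSubmodClosed.Build k S (deg_in J) (deg_in_closed J).

Lemma deg_inM (J1 J2 J : pred nat) (p q : S) :
  (forall i j, J1 i -> J2 j -> J (i + j)%N) ->
  p \in deg_in J1 -> q \in deg_in J2 -> p * q \in deg_in J.
Proof.
move=> hJ /deg_inP hp /deg_inP hq; apply/deg_inP => m /msuppM_le.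
by case/allpairsP=> -[m1 m2] /= [/hp h1 /hq h2 ->]; rewrite mdegD; apply: hJ.
Qed.

Lemma lin_form_homog v : lin_form v \is 1.-homog.
Proof.
apply: rpred_sum => i _; apply: rpredZ; rewrite dhomogX.
by apply/eqP; apply: mdeg1.
Qed.

Lemma gl_sym_lin g v : gl_sym g (lin_form v) = lin_form (g *m v).
Proof.
rewrite /lin_form raddf_sum /=.
under eq_bigr => i _.
  rewrite linearZ /= /gl_sym comp_mpolyXU -tnth_nth tnth_mktuple /lin_form scaler_sumr.
  under eq_bigr => j _ do rewrite mxE scalerA mulrC.
over.
rewrite exchange_big; apply: eq_bigr => j _.
by rewrite -scaler_suml mxE.
Qed.

Lemma gl_sym_deg g (J : pred nat) p : p \in deg_in J -> gl_sym g p \in deg_in J.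
Proof.
move=> /deg_inP hp; rewrite /gl_sym comp_mpolyEX big_seq.
apply: rpred_sum => m /hp hm; apply: rpredZ; rewrite comp_mpolyX.
have hom : \prod_(i < n) tnth [tuple lin_form (col i g) | i < n] i ^+ m i
    \is (mdeg m).-homog.
  rewrite mdegE.
  elim/big_ind2: _ => [|x e y f hx hf|i _]; first exact: dhomog1.
    exact: dhomogM.
  rewrite -[X in X.-homog]mul1n; apply: dhomogMn.
  by rewrite tnth_mktuple lin_form_homog.
by apply/deg_inP => m' /(dhomog_mf hom) /= ->.
Qed.

End Polynomials.

Section Veronese.
Variables (k : comNzRingType) (n : nat).

(* S^(d) *)
Definition veronese_pred (d : nat) : {pred {mpoly k[n]}} :=
  deg_in [pred j | j == 0 %[mod d]].

(* S^(>= r, d) *)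
Definition veronese_mod_pred (r d : nat) : {pred {mpoly k[n]}} :=
  deg_in [pred j | (r <= j)%N & j == r %[mod d]].

HB.instance Definition _ d := GRing.SubmodClosed.on (veronese_pred d).
HB.instance Definition _ r d := GRing.SubmodClosed.on (veronese_mod_pred r d).

Fact veronese_mulr_closed d : mulr_closed (veronese_pred d).
Proof.
split=> [|p q].
  by apply/deg_inP => m; rewrite msupp1 mem_seq1 => /eqP ->; rewrite mdeg0 /=.
apply: deg_inM => i j /= /eqP hi /eqP hj.
by rewrite -modnDm hi hj modnDm.
Qed.

HB.instance Definition _ d :=
  GRing.isMulClosed.Build _ (veronese_pred d) (veronese_mulr_closed d).

Record veronese (d : nat) := Veronese {
  veronese_val :> {mpoly k[n]};
  veronese_valP : veronese_val \in veronese_pred d }.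

HB.instance Definition _ d := [isSub for @veronese_val d].
HB.instance Definition _ d := [Choice of veronese d by <:].
HB.instance Definition _ d := [SubChoice_isSubAlgebra of veronese d by <:].
HB.instance Definition _ d := [SubNzRing_isSubComNzRing of veronese d by <:].

Record veronese_mod (r d : nat) := VeroneseMod {
  veronese_mod_val :> {mpoly k[n]};
  veronese_mod_valP : veronese_mod_val \in veronese_mod_pred r d }.

HB.instance Definition _ r d := [isSub for @veronese_mod_val r d].
HB.instance Definition _ r d := [Choice of veronese_mod r d by <:].
HB.instance Definition _ r d := [SubChoice_isSubZmodule of veronese_mod r d by <:].

Fact veronese_mod_scale_subproof r d (a : veronese d) (x : veronese_mod r d) :
  val a * val x \in veronese_mod_pred r d.
Proof.
apply: deg_inM (veronese_valP a) (veronese_mod_valP x) => i j /= /eqP hi.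
case/andP=> hr /eqP hj; rewrite (leq_trans hr (leq_addl _ _)) /=.
by rewrite -modnDm hi hj modnDm add0n.
Qed.

Definition veronese_mod_scale r d (a : veronese d) (x : veronese_mod r d) :=
  VeroneseMod (veronese_mod_scale_subproof a x).

Fact veronese_mod_scaleA r d a b (x : veronese_mod r d) :
  veronese_mod_scale a (veronese_mod_scale b x) = veronese_mod_scale (a * b) x.
Proof. by apply: val_inj; rewrite /= mulrA. Qed.

Fact veronese_mod_scale1 r d :
  left_id 1 (@veronese_mod_scale r d).
Proof. by move=> x; apply: val_inj; rewrite /= mul1r. Qed.

Fact veronese_mod_scaleDr r d :
  right_distributive (@veronese_mod_scale r d) +%R.
Proof. by move=> a x y; apply: val_inj; rewrite /= mulrDr. Qed.

Fact veronese_mod_scaleDl r d (x : veronese_mod r d) :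
  {morph (@veronese_mod_scale r d)^~ x : a b / a + b}.
Proof. by move=> a b; apply: val_inj; rewrite /= mulrDl. Qed.

HB.instance Definition _ r d :=
  GRing.Zmodule_isLmodule.Build (veronese d) (veronese_mod r d)
    (@veronese_mod_scaleA r d) (@veronese_mod_scale1 r d)
    (@veronese_mod_scaleDr r d) (@veronese_mod_scaleDl r d).

Definition gl_veronese d (g : 'M[k]_n) (a : veronese d) : veronese d :=
  Veronese (gl_sym_deg g (veronese_valP a)).

Fact gl_veronese_linear d g : linear (@gl_veronese d g).
Proof. by move=> c a b; apply: val_inj; rewrite /= linearP. Qed.

HB.instance Definition _ d g :=
  GRing.isLinear.Build k _ _ _ (@gl_veronese d g) (@gl_veronese_linear d g).

Definition gl_veronese_mod r d (g : 'M[k]_n) (x : veronese_mod r d) :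
    veronese_mod r d :=
  VeroneseMod (gl_sym_deg g (veronese_mod_valP x)).

End Veronese.

Section SchurFunctor.
Variables (k : comNzRingType) (n : nat).
Local Notation S := {mpoly k[n]}.

Fixpoint tpow (p : nat) : lmodType k :=
  if p is p'.+1 then tensor S (tpow p') else k^o.

(* f i_1 (x) ... (x) f i_p, for s = [:: i_1; ...; i_p] *)
Fixpoint ptens (I : Type) (s : seq I) (f : I -> S) : tpow (size s) :=
  if s is i :: s' then tens (f i) (ptens s' f) else (1 : k^o).

Fixpoint gl_tpow (g : 'M[k]_n) (p : nat) : {linear tpow p -> tpow p} :=
  if p is p'.+1 then tens_map (gl_sym g) (gl_tpow g p') else idfun.

Lemma gl_tpow_ptens g (I : Type) (s : seq I) (f : I -> S) :
  gl_tpow g (size s) (ptens s f) = ptens s (fun i => gl_sym g (f i)).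
Proof. by elim: s => [//|i s IH]; rewrite /= tens_mapE IH. Qed.

Variable D : {fset nat * nat}.

(* A cell is a pair (row, column), rows being numbered downwards; the rows of
   D are listed from bottom to top. *)
Definition diag_rows : seq nat :=
  sort geq (undup [seq c.1 | c <- (D : seq (nat * nat))]).

(* The image of the tensor product over the columns of D of the wedges of the
   vectors [v c], c ranging over the column from top to bottom: the product of
   the antisymmetrizers of the columns is the signed sum over all permutations
   of the cells that preserve each column.  The i-th tensor factor of the
   ambient module is S = Sym V rather than its direct summand S^|R_i|(V). *)
Definition schur_gen (v : D -> 'cV[k]_n) : tpow (size diag_rows) :=
  \sum_(w : {perm D} | [forall c, (val (w c)).2 == (val c).2])
    (-1) ^+ w *:
      ptens diag_rows (fun i => \prod_(c : D | (val c).1 == i) lin_form (v (w c))).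

(* Pure wedges span the exterior powers, so the image of the composite map
   defining the Schur functor is the k-span of the images of the pure wedges. *)
Definition schur_pred : {pred tpow (size diag_rows)} :=
  fun x => `[< lspan (fun y => exists v, y = schur_gen v) x >].

Fact schur_closed : submod_closed schur_pred.
Proof.
split=> [|c x y]; first by apply/asboolP; left.
by move=> /asboolP hx /asboolP hy; apply/asboolP; apply: lspanD.
Qed.

HB.instance Definition _ :=
  GRing.isSubmodClosed.Build k _ schur_pred schur_closed.

Record schur := Schur {
  schur_val :> tpow (size diag_rows);
  schur_valP : schur_val \in schur_pred }.

HB.instance Definition _ := [isSub for schur_val].
HB.instance Definition _ := [Choice of schur by <:].
HB.instance Definition _ := [SubChoice_isSubLmodule of schur by <:].

Lemma gl_tpow_schur_gen g v :
  gl_tpow g _ (schur_gen v) = schur_gen (fun c => g *m v c).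
Proof.
rewrite /schur_gen raddf_sum; apply: eq_bigr => w _ /=.
rewrite linearZ /= gl_tpow_ptens; congr (_ *: _).
congr (ptens _ _); apply/funext => i; rewrite rmorph_prod.
by apply: eq_bigr => c _; apply: gl_sym_lin.
Qed.

Fact gl_schur_subproof g (x : schur) : gl_tpow g _ (schur_val x) \in schur_pred.
Proof.
apply/asboolP; move: (schur_val x) (schur_valP x) => u /asboolP.
elim=> [|c y z [v ->] _ IH]; first by rewrite linear0; left.
by rewrite linearP; right => //; exists (fun c => g *m v c);
  rewrite gl_tpow_schur_gen.
Qed.

Definition gl_schur (g : 'M[k]_n) (x : schur) : schur :=
  Schur (gl_schur_subproof g x).

Fact gl_schur_linear g : linear (gl_schur g).
Proof. by move=> c x y; apply: val_inj; rewrite /= linearP. Qed.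

HB.instance Definition _ g :=
  GRing.isLinear.Build k _ _ _ (gl_schur g) (gl_schur_linear g).

End SchurFunctor.

(* The rows of the ribbon of composition a, from bottom to top, the bottom row
   starting in column c; each row starts in the last column of the one below. *)
Fixpoint ribbon_cells (c : nat) (a : seq nat) : seq (nat * nat) :=
  if a is m :: a' then
    [seq (size a', c + t)%N | t <- iota 0 m] ++ ribbon_cells (c + m.-1) a'
  else [::].

Definition ribbon (a : seq nat) : {fset nat * nat} :=
  [fset c in ribbon_cells 0 a]%fset.

Section FreeTerms.
Variables (k : comNzRingType) (n d : nat) (D : {fset nat * nat}).
Local Notation R := (veronese k n d).
Local Notation F := (base_change R (schur k n D)).

Definition gl_bc (g : 'M[k]_n) (x : F) : F :=
  tens_map (gl_veronese g) (gl_schur g) x.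

(* The degree-j component of R (x) S^D(V); S^D(V) lies in degree |D|. *)
Definition bc_homog (j : nat) (x : F) : Prop :=
  @lspan k (tensor R (schur k n D))
    (fun z => exists (e : nat) (a : R) (y : schur k n D),
       [/\ (e + #|` D| = j)%N, val a \is e.-homog & z = tens a y]) x.

End FreeTerms.

(* Main.v *)
Require Import Defs.
From HB Require Import structures.
From mathcomp Require Import all_boot all_order all_fingroup all_algebra.
From mathcomp Require Import finmap.
From mathcomp Require Import mpoly.
From mathcomp.classical Require Import boolp.

Set Implicit Arguments.
Unset Strict Implicit.
Unset Printing Implicit Defensive.

Import GRing.Theory.

Local Open Scope ring_scope.

(** The Schur functor of a ribbon with rows [a_1, .., a_l] is the module of all
    tensors in S^[a_1] (x) .. (x) S^[a_l] that are killed by every product of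
    two adjacent factors.  With this description the resolution is easy to
    write down: R (x) S^D(V), for the ribbon D of (d^i, r), consists of the
    tensors in R (x) S^d (x) .. (x) S^d (x) S^r killed by every adjacent
    product except possibly the first one, and the differential is that first
    product, called [fuse].  Its entries lie in S^d, it commutes with GL(V)
    because GL(V) acts by ring morphisms, its square vanishes because
    multiplication is associative, and its kernel is made of the tensors
    killed by all adjacent products.  Exactness says that every such tensor
    is fused from one that has an additional factor of degree d.

    Both facts, the description of the Schur functor and exactness, are
    instances of one triangularity argument.  Expand tensors in tuples of
    monomials, and say that two consecutive monomials u, v form a descent if
    some letter of u is larger than some letter of v.  Among the
    factorizations m = u v with prescribed degrees, exactly one is not a
    descent, the one which sorts the letters of m; it is also the one that
    maximizes the sum of the letters of v ([sorted_split_max]).  So if a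
    tensor is killed by the product of two adjacent factors, its coefficient
    at a tuple which has no descent there is minus the sum of its coefficients
    at tuples of lower rank, for the order on tuples that compares sums of
    letters starting from the last entry ([nonzero_descent]).  A tensor killed
    by all products is thus determined by its coefficients at the tuples with
    descents everywhere, and the module of these tensors is spanned by any
    family that has one member with each of these leading tuples
    ([ribbon_generation]).

    Two families are used.  Filling the rows of the ribbon with the sorted
    letters of a tuple with descents everywhere gives a filling with strict
    columns; the alternating sum over the column permutations of that filling
    leads with the tuple itself, since any other column permutation raises the
    sum of letters of the highest row that it changes ([fill_gen_leading]).
    These tensors lie in the Schur functor and form a basis of it
    ([schur_basis]) over any ring k.  For exactness, split off the smallest
    letters m' of the first monomial m = m' m'' of such a tuple, so that m''
    has degree d: the new tuple (m'', ..) still has descents everywhere, hence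
    leads an element y of the next Schur functor, and m' (x) y is fused into
    a tensor which leads with the original tuple ([ribbon_lift]). *)

(** * Coefficients of tensors of polynomials *)

Section TensorCoefficients.
Variables (k : comNzRingType) (n : nat).
Local Notation S := {mpoly k[n]}.
Local Notation mon := 'X_{1..n}.

Lemma tens0l (M N : lmodType k) (y : N) : tens (0 : M) y = 0.
Proof. by rewrite -(scale0r (0 : M)) tensZl scale0r. Qed.

Lemma tens0r (M N : lmodType k) (a : M) : tens a (0 : N) = 0.
Proof. by rewrite -(scale0r (0 : N)) tensZr scale0r. Qed.

Lemma tens_map0 (M N M' N' : lmodType k) (f : {linear M -> M'})
  (g : {linear N -> N'}) : tens_map f g 0 = 0.
Proof. exact: linear0. Qed.

Lemma tens_mapD (M N M' N' : lmodType k) (f : {linear M -> M'})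
  (g : {linear N -> N'}) : {morph tens_map f g : x y / x + y}.
Proof. exact: linearD. Qed.

Section Slice.
Variable N : lmodType k.

Definition slice (m : mon) : tensor S N -> N :=
  tens_lift (fun (a : S) (y : N) => a@_m *: y).

Fact slice_bilinear m : bilinear_map (fun (a : S) (y : N) => a@_m *: y).
Proof.
split=> [y c a b|a c x y]; first by rewrite mcoeffD mcoeffZ scalerDl scalerA.
by rewrite scalerDr !scalerA mulrC.
Qed.

Fact slice_linear m : linear (slice m).
Proof. exact: tens_lift_linear (slice_bilinear m). Qed.

HB.instance Definition _ m := GRing.isLinear.Build k _ _ _ (slice m)
  (slice_linear m).

Lemma slice0 m : slice m 0 = 0. Proof. exact: linear0. Qed.
Lemma sliceD m x y : slice m (x + y) = slice m x + slice m y.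
Proof. exact: linearD. Qed.

Lemma sliceE m a y : slice m (tens a y) = a@_m *: y.
Proof. exact: tens_liftE (slice_bilinear m). Qed.

(** The slices are eventually zero; the bound is left free so that two
    tensors can be decomposed over the same monomials. *)
Lemma slice_dec (x : tensor S N) :
  exists b0, forall b, (b0 <= b)%N ->
    x = \sum_(m : 'X_{1..n < b}) tens 'X_[m] (slice m x).
Proof.
elim/tens_ind: x => [|a y u [b0 IH]].
  exists 0%N => b _; rewrite big1 // => m _.
  by rewrite slice0 tens0r.
exists (maxn b0 (msize a)) => b; rewrite geq_max => /andP[b0b ab].
under eq_bigr => m _ do rewrite linearD tensDr /= sliceE tensZr -tensZl.
rewrite big_split /= -(IH b b0b); congr (_ + _).
rewrite {1}(mpolywE ab).
exact: (big_morph (fun a => tens a y) (fun a b => tensDl a b y) (tens0l S y)).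
Qed.

End Slice.

Section Fuse.
Variable N : lmodType k.

Definition lmul (a : S) : tensor S N -> tensor S N :=
  tens_lift (fun (b : S) (y : N) => tens (a * b) y).

Fact lmul_bilinear a : bilinear_map (fun (b : S) (y : N) => tens (a * b) y).
Proof.
split=> [y c b b'|b c x y]; last by rewrite tensDr tensZr.
by rewrite mulrDr -scalerAr tensDl tensZl.
Qed.

Fact lmul_linear a : linear (lmul a).
Proof. exact: tens_lift_linear (lmul_bilinear a). Qed.

HB.instance Definition _ a := GRing.isLinear.Build k _ _ _ (lmul a)
  (lmul_linear a).

Lemma lmul0 a : lmul a 0 = 0. Proof. exact: linear0. Qed.
Lemma lmulD a x y : lmul a (x + y) = lmul a x + lmul a y.
Proof. exact: linearD. Qed.

Lemma lmulE a b (y : N) : lmul a (tens b y) = tens (a * b) y.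
Proof. exact: (tens_liftE _ _ (lmul_bilinear a)). Qed.

Lemma lmulA a b z : lmul a (lmul b z) = lmul (a * b) z.
Proof.
elim/tens_ind: z => [|c y u IH]; first by rewrite !lmul0.
by rewrite !lmulD IH !lmulE mulrA.
Qed.

Definition fuse : tensor S (tensor S N) -> tensor S N := tens_lift lmul.

Fact fuse_bilinear : bilinear_map lmul.
Proof.
split=> [z c a b|a]; last exact: lmul_linear.
elim/tens_ind: z => [|b' y u IH]; first by rewrite !lmul0 scaler0 addr0.
rewrite !lmulD IH !lmulE scalerDr addrACA; congr (_ + _).
by rewrite mulrDl tensDl -scalerAl tensZl.
Qed.

Fact fuse_linear : linear fuse.
Proof. exact: tens_lift_linear fuse_bilinear. Qed.

HB.instance Definition _ := GRing.isLinear.Build k _ _ _ fuse fuse_linear.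

Lemma fuse0 : fuse 0 = 0. Proof. exact: linear0. Qed.
Lemma fuseD x y : fuse (x + y) = fuse x + fuse y.
Proof. exact: linearD. Qed.

Lemma fuseE a z : fuse (tens a z) = lmul a z.
Proof. exact: tens_liftE fuse_bilinear. Qed.

Lemma slice_fuse m (x : tensor S (tensor S N)) :
  slice m (fuse x) =
    \sum_(k : 'X_{1..n < (mdeg m).+1, (mdeg m).+1} | m == (k.1 + k.2)%MM)
      slice k.2 (slice k.1 x).
Proof.
elim/tens_ind: x => [|a z u IH].
  by rewrite fuse0 slice0 big1 // => i _; rewrite !slice0.
rewrite fuseD sliceD IH fuseE.
under [RHS]eq_bigr => i _ do rewrite !sliceD sliceE linearZ /=.
rewrite big_split /=; congr (_ + _).
elim/tens_ind: z {u IH} => [|b y u IH].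
  by rewrite lmul0 slice0 big1 // => i _; rewrite slice0 scaler0.
rewrite lmulD sliceD IH lmulE sliceE mcoeffM scaler_suml.
under [RHS]eq_bigr => i _ do rewrite sliceD scalerDr sliceE scalerA.
by rewrite big_split.
Qed.

End Fuse.

Lemma fuse_lmul (N : lmodType k) a (x : tensor S (tensor S N)) :
  fuse (lmul a x) = lmul a (fuse x).
Proof.
elim/tens_ind: x => [|b z u IH]; first by rewrite lmul0 fuse0 lmul0.
rewrite lmulD !fuseD lmulD IH; congr (_ + _).
by rewrite lmulE !fuseE lmulA.
Qed.

(** Associativity of the product, which makes the differential square to
    zero. *)
Lemma fuse_assoc (N : lmodType k) (x : tensor S (tensor S (tensor S N))) :
  fuse (fuse x) = fuse (tens_map idfun (@fuse N) x).
Proof.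
elim/tens_ind: x => [|a z u IH]; first by rewrite tens_map0 !fuse0.
rewrite !fuseD tens_mapD !fuseD {}IH tens_mapE; congr (_ + _).
by rewrite !fuseE fuse_lmul.
Qed.

Lemma slice_map (N N' : lmodType k) (g : {linear N -> N'}) m x :
  slice m (tens_map idfun g x) = g (slice m x).
Proof.
elim/tens_ind: x => [|a z u IH]; first by rewrite tens_map0 !slice0 linear0.
by rewrite tens_mapD !sliceD IH tens_mapE !sliceE linearD linearZ.
Qed.

(** Reading tensors as functions on tuples hides the length of the tensor
    power, which is only propositionally the number of rows of a ribbon. *)
Fixpoint cf (p : nat) : tpow k n p -> seq mon -> k :=
  if p is p'.+1 return tpow k n p -> seq mon -> k then
    fun x s => if s is m :: s' then cf (slice m x) s' else 0
  else fun x s => if s is [::] then x else 0.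

Fact cf_linear p s : linear (fun x : tpow k n p => cf x s : k^o).
Proof.
elim: p s => [|p IH] [|m s] c x y //=; rewrite ?scaler0 ?addr0 //.
by rewrite linearP IH.
Qed.

(** [cf] with its arguments in the order that makes it a linear form. *)
Definition cfs s p (x : tpow k n p) : k^o := cf x s.
HB.instance Definition _ s p := GRing.isLinear.Build k _ _ _ (@cfs s p)
  (@cf_linear p s).

Lemma cfD s p (x y : tpow k n p) : cf (x + y) s = cf x s + cf y s.
Proof. exact: (linearD (@cfs s p)). Qed.
Lemma cfB s p (x y : tpow k n p) : cf (x - y) s = cf x s - cf y s.
Proof. exact: (linearB (@cfs s p)). Qed.
Lemma cf0 s p : cf (0 : tpow k n p) s = 0.
Proof. exact: (linear0 (@cfs s p)). Qed.
Lemma cfZ s p c (x : tpow k n p) : cf (c *: x) s = c * cf x s.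
Proof. by rewrite -[RHS]addr0 -(cf0 s p) -[_ *: x]addr0; apply: cf_linear. Qed.
Lemma cf_sum s p (I : Type) (r : seq I) P (F : I -> tpow k n p) :
  cf (\sum_(i <- r | P i) F i) s = \sum_(i <- r | P i) cf (F i) s.
Proof. exact: (linear_sum (@cfs s p)). Qed.

Lemma cf_size p (x : tpow k n p) s : cf x s != 0 -> size s = p.
Proof.
elim: p x s => [|p IH] x [|m s] //=; rewrite ?eqxx //.
by move/IH ->.
Qed.

(** A tensor is rebuilt from its slices, which have one factor less. *)
Lemma cf_eq0 p (x : tpow k n p) : (forall s, cf x s = 0) -> x = 0.
Proof.
elim: p x => [|p IH] x x0; first exact: (x0 [::]).
have [b /(_ b (leqnn b)) ->] := slice_dec x.
rewrite big1 // => m _; rewrite (IH (slice m x)).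
  by rewrite tens0r.
by move=> s; apply: (x0 (bmnm m :: s)).
Qed.

Lemma cf_inj p (x y : tpow k n p) : cf x =1 cf y -> x = y.
Proof.
move=> xy; apply/eqP; rewrite -subr_eq0; apply/eqP/cf_eq0 => s.
by rewrite cfB xy subrr.
Qed.

Lemma slice_bound (N : lmodType k) (x : tensor S N) :
  exists b, forall m, (b <= mdeg m)%N -> slice m x = 0.
Proof.
elim/tens_ind: x => [|a y u [b IH]]; first by exists 0%N => m _; rewrite slice0.
exists (maxn b (msize a)) => m; rewrite geq_max => /andP[bm am].
rewrite sliceD IH // addr0 sliceE.
by rewrite (memN_msupp_eq0 (msize_mdeg_ge am)) scale0r.
Qed.

Lemma cf_fuse p (x : tpow k n p.+2) m s :
  cf (fuse x : tpow k n p.+1) (m :: s) =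
    \sum_(k : 'X_{1..n < (mdeg m).+1, (mdeg m).+1} | m == (k.1 + k.2)%MM)
      cf x (bmnm k.1 :: bmnm k.2 :: s).
Proof. by rewrite /= slice_fuse cf_sum. Qed.

Lemma cf_tens p (q : S) (y : tpow k n p) m s :
  cf (tens q y : tpow k n p.+1) (m :: s) = q@_m * cf y s.
Proof. by rewrite /= sliceE cfZ. Qed.

Lemma cf_ptens (I : Type) (rs : seq I) (f : I -> S) s :
  cf (ptens rs f) s =
    if size s == size rs then \prod_(im <- zip rs s) (f im.1)@_(im.2) else 0.
Proof.
elim: rs s => [|i rs IH] [|m s] //=; first by rewrite big_nil.
rewrite sliceE cfZ IH eqSS; case: eqP => _; last by rewrite mulr0.
by rewrite big_cons.
Qed.

(** Transport along an equality of lengths.  Making it total spares every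
    later definition a proof that the lengths agree. *)
Definition tcast p q (x : tpow k n p) : tpow k n q :=
  if p =P q is ReflectT e then eq_rect p (tpow k n) x q e else 0.

Fact tcast_linear p q : linear (@tcast p q).
Proof.
by rewrite /tcast => c x y; case: eqP => [e|_]; [case: _ / e | rewrite scaler0 addr0].
Qed.
HB.instance Definition _ p q := GRing.isLinear.Build k _ _ _ (@tcast p q)
  (@tcast_linear p q).

Lemma cf_tcast p q (x : tpow k n p) s : p = q -> cf (tcast q x) s = cf x s.
Proof.
move=> e; rewrite /tcast; case: eqP => // e'; rewrite {e}.
by case: _ / e'.
Qed.

Lemma tcastK p q (x : tpow k n p) : p = q -> tcast p (tcast q x) = x.
Proof. by move=> e; apply: cf_inj => s; rewrite !cf_tcast. Qed.

Lemma gl_tcast g p q (x : tpow k n p) :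
  gl_tpow g q (tcast q x) = tcast q (gl_tpow g p x).
Proof.
by rewrite /tcast; case: eqP => [e|_]; [case: _ / e | rewrite linear0].
Qed.

Lemma gl_tpowS g p (x : tpow k n p.+1) :
  gl_tpow g p.+1 x = tens_map (gl_sym g) (gl_tpow g p) x.
Proof. by []. Qed.

Lemma gl_lmul g p a (x : tpow k n p.+1) :
  gl_tpow g p.+1 (lmul a x) = lmul (gl_sym g a) (gl_tpow g p.+1 x).
Proof.
rewrite !gl_tpowS; elim/tens_ind: x => [|b y u IH].
  by rewrite tens_map0 !lmul0 tens_map0.
by rewrite tens_mapD !lmulD tens_mapD IH !(tens_mapE, lmulE) rmorphM.
Qed.

Lemma gl_fuse g p (x : tpow k n p.+2) :
  gl_tpow g p.+1 (fuse x) = fuse (gl_tpow g p.+2 x).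
Proof.
rewrite [in RHS]gl_tpowS; elim/tens_ind: x => [|a z u IH].
  by rewrite tens_map0 !fuse0 linear0.
by rewrite tens_mapD !fuseD linearD IH tens_mapE !fuseE gl_lmul.
Qed.

End TensorCoefficients.

(** * Descents and sorted factorizations of monomials *)

Section Monomials.
Variable n : nat.
Local Notation mon := 'X_{1..n}.

(** Failure of the sorted order: the sorted word of u v is not the sorted word
    of u followed by the one of v. *)
Definition desc (u v : mon) : bool :=
  [exists i : 'I_n, exists j : 'I_n, [&& (j < i)%N, (0 < u i)%N & (0 < v j)%N]].

Lemma descP (u v : mon) :
  reflect (exists i j : 'I_n, [/\ (j < i)%N, (0 < u i)%N & (0 < v j)%N])
          (desc u v).
Proof.
apply: (iffP existsP) => [[i /existsP[j /and3P[]]]|[i [j [ji ui vj]]]].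
  by move=> *; exists i, j.
by exists i; apply/existsP; exists j; apply/and3P.
Qed.

(** With c the largest letter of u, the monomial v' has at most as many
    letters above c as v, and at least as many below: comparing letters with c shows that passing
    from v to v' lowers the sum of the letters.  Here [mnmwgt] is that sum,
    with letters counted from 1. *)
Lemma sorted_split_max (u v u' v' : mon) : ~~ desc u v ->
  (u + v = u' + v')%MM -> mdeg v = mdeg v' -> v != v' ->
  (mnmwgt v' < mnmwgt v)%N.
Proof.
move=> nd e dv /eqP nv.
pose c := (\max_(i < n | 0 < u i) i)%N.
have uc (i : 'I_n) : (0 < u i)%N -> (i <= c)%N by move=> ui; apply: leq_bigmax_cond.
have vc (j : 'I_n) : (0 < v j)%N -> (c <= j)%N.
  move=> vj; apply/bigmax_leqP => i ui; rewrite leqNgt.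
  by apply: contra nd => ji; apply/descP; exists i, j.
have ei i : (u i + v i = u' i + v' i)%N by rewrite -!mnmDE e.
(* the inequality (v i - v' i) * (i - c) >= 0, without subtraction *)
have H (i : 'I_n) : (v' i * i.+1 + v i * c.+1 <= v i * i.+1 + v' i * c.+1 ?= iff
                      ((i == c :> nat) || (v i == v' i)))%N.
  apply/leqifP; have := ei i; case: (ltngtP (val i) c) => /= [ic|ci|ic] E.
  - have v0 : v i = 0%N.
      by apply/eqP; rewrite -leqn0 leqNgt; apply: contraL ic => /vc; rewrite -leqNgt.
    rewrite v0; case: eqP => [<-//|/eqP]; rewrite eq_sym -lt0n => v'0.
    by rewrite !mul0n addn0 add0n ltn_pmul2l.
  - have u0 : u i = 0%N.
      by apply/eqP; rewrite -leqn0 leqNgt; apply: contraL ci => /uc; rewrite -leqNgt.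
    have le : (v' i <= v i)%N by rewrite u0 in E; rewrite -[v i]add0n E leq_addl.
    case: eqP => [->|/eqP ne]; first by rewrite addnC.
    have [a -> a0] : exists2 a, v i = (v' i + a)%N & (0 < a)%N.
      by exists (v i - v' i)%N; [rewrite subnKC | rewrite subn_gt0 ltn_neqAle eq_sym ne].
    by rewrite !mulnDl addnA [leqRHS]addnAC ltn_add2l ltn_pmul2l.
  - by rewrite ic addnC.
have := leqif_sum (fun i (_ : predT i) => H i).
rewrite !big_split /= -!big_distrl /= -!mdegE -!/(mnmwgt _) dv => /leqifP.
case: forallP => [E|_]; last by rewrite ltn_add2r.
case: nv; have E' (i : 'I_n) : i != c :> nat -> v i = v' i.
  by move=> ic; have := E i; rewrite (negPf ic) => /eqP.
apply/mnmP => i; case: (eqVneq (i : nat) c) => [ic|/E' //].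
move: dv; rewrite !mdegE (bigD1 i) //= [RHS](bigD1 i) //=.
have -> : (\sum_(j < n | j != i) v j = \sum_(j < n | j != i) v' j)%N.
  by apply: eq_bigr => j ji; apply: E'; rewrite -ic.
by move/addIn.
Qed.

(** Letters are moved into v one at a time, always the largest one left. *)
Lemma sorted_split (m : mon) a : (a <= mdeg m)%N ->
  exists u v : mon, [/\ m = (u + v)%MM, mdeg u = a & ~~ desc u v].
Proof.
move=> am; have : mdeg m = (a + (mdeg m - a))%N by rewrite subnKC.
move: (mdeg m - a)%N => b {am}; elim: b m => [|b IH] m.
  rewrite addn0 => am; exists m, 0%MM; split; rewrite ?addm0 //.
  by apply/descP => -[i [j [_ _]]]; rewrite mnm0E.
rewrite addnS => dm.
have [j0 mj0] : exists j0 : 'I_n, (0 < m j0)%N.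
  apply/existsP; apply: contra_eqT dm => /existsPn m0.
  rewrite mdegE big1 // => i _; apply/eqP.
  by have := m0 i; rewrite -eqn0Ngt.
case: (@arg_maxnP _ j0 (fun j => 0 < m j)%N (fun j => val j) mj0) => j mj jmax.
have mE : m = ((m - U_(j)) + U_(j))%MM.
  apply/mnmP => i; rewrite mnmDE mnmBE mnm1E subnK //.
  by case: eqP => [<-|].
have [|u [v [E du nd]]] := IH (m - U_(j))%MM.
  by apply/eqP; rewrite -eqSS -dm [in X in _ == X]mE mdegD mdeg1 addn1.
exists u, (v + U_(j))%MM; split=> //; first by rewrite mE E addmA.
apply: contra nd => /descP[i [j' [ji ui]]]; rewrite mnmDE mnm1E.
case: (j =P j') => [jj'|_]; last first.
  by rewrite addn0 => vj; apply/descP; exists i, j'.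
suff mi : (0 < m i)%N by have := jmax i mi; rewrite /= jj' leqNgt ji.
by rewrite mE E !mnmDE -addnA ltn_addr.
Qed.

Lemma mnmwgt_le (m : mon) : (mnmwgt m <= n * mdeg m)%N.
Proof.
rewrite mdegE big_distrr /=; apply: leq_sum => i _.
by rewrite mulnC leq_mul2r ltn_ord orbT.
Qed.

Section Rank.
Variable B : nat.

(** For weights below B this number orders tuples by comparing the weights of
    their last entries first. *)
Definition rank (s : seq mon) : nat :=
  foldr (fun m acc => mnmwgt m + B * acc)%N 0%N s.

Lemma rank_bound s : all (fun m => mnmwgt m < B)%N s -> (rank s < B ^ size s)%N.
Proof.
elim: s => [//|m s IH] /= /andP[mB /IH le].
rewrite expnS; apply: leq_trans (_ : B * (rank s).+1 <= _)%N.
  by rewrite mulnS ltn_add2r.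
by rewrite leq_mul2l le orbT.
Qed.

Lemma rank_top pre pre' s s' : size pre = size pre' ->
  all (fun m => mnmwgt m < B)%N pre -> (rank s < rank s')%N ->
  (rank (pre ++ s) < rank (pre' ++ s'))%N.
Proof.
elim: pre pre' => [|m pre IH] [|m' pre'] //= [e] /andP[mB aB] lt.
have {}IH := IH _ e aB lt.
apply: leq_trans (leq_addl _ _); apply: leq_trans (_ : B * (rank (pre ++ s)).+1 <= _)%N.
  by rewrite mulnS ltn_add2r.
by rewrite leq_mul2l IH orbT.
Qed.

Lemma rank_head (m m' : mon) s :
  (mnmwgt m < mnmwgt m')%N -> (rank (m :: s) < rank (m' :: s))%N.
Proof. by rewrite /= ltn_add2r. Qed.

(** Exchanging a pair of consecutive monomials keeps the sum of their weights,
    so only the weight of the later one matters: it counts B - 1 times in excess. *)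
Lemma rank_exchange pre (u v u' v' : mon) s : (1 < B)%N ->
  (u + v = u' + v')%MM -> (mnmwgt v' < mnmwgt v)%N ->
  (rank (pre ++ [:: u', v' & s]) < rank (pre ++ [:: u, v & s]))%N.
Proof.
move=> B1 e lt; elim: pre => [|m pre IH] /=; last first.
  by rewrite ltn_add2l ltn_pmul2l // (ltn_trans _ B1).
have := congr1 mnmwgt e; rewrite !mnmwgtD => E.
have [b [bE b0]] : exists b, B = b.+1 /\ (0 < b)%N.
  by exists B.-1; case: B B1 => [|[|b]].
rewrite !mulnDr !addnA ltn_add2r bE !mulSn !addnA -E ltn_add2l.
by rewrite ltn_pmul2l.
Qed.

End Rank.

Definition mons (d : nat) : seq mon :=
  [seq bmnm x | x : 'X_{1..n < d.+1} <- enum {: 'X_{1..n < d.+1}} & mdeg (bmnm x) == d].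

Fixpoint tups (a : seq nat) : seq (seq mon) :=
  if a is d :: a' then [seq m :: s | m <- mons d, s <- tups a'] else [:: [::]].

Lemma mem_mons d m : (m \in mons d) = (mdeg m == d).
Proof.
apply/mapP/eqP => [[x]|md]; first by rewrite mem_filter => /andP[/eqP xd _] ->.
have lt : (mdeg m < d.+1)%N by rewrite md.
by exists (BMultinom lt); rewrite // mem_filter /= md eqxx mem_enum.
Qed.

Lemma mem_tups a s : (s \in tups a) = (map mdeg s == a).
Proof.
elim: a s => [|d a IH] [|m s] //=; first by apply/allpairsP => -[[? ?] []].
rewrite eqseq_cons -IH -mem_mons.
apply/allpairsP/andP => [[[m' s'] /= [? ?] [-> ->]]//|[hm hs]].
by exists (m, s).
Qed.

Lemma tups_uniq a : uniq (tups a).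
Proof.
elim: a => [//|d a IH] /=; apply: allpairs_uniq => //.
  rewrite map_inj_uniq; first by rewrite filter_uniq ?enum_uniq.
  exact: val_inj.
by move=> [m s] [m' s'] _ _ /= [-> ->].
Qed.

Lemma not_path_desc (m : mon) s : ~~ path desc m s ->
  exists pre u v suf, m :: s = pre ++ [:: u, v & suf] /\ ~~ desc u v.
Proof.
elim: s m => [//|m' s IH] m /=; rewrite negb_and => /orP[nd|/IH].
  by exists [::], m, m', s.
by move=> [pre [u [v [suf [-> nd]]]]]; exists (m :: pre), u, v, suf.
Qed.

End Monomials.

(** * Tensors killed by adjacent products *)

Section Ribbons.
Variables (k : comNzRingType) (n : nat).
Local Notation S := {mpoly k[n]}.
Local Notation mon := 'X_{1..n}.

(** For the coefficient function of a tensor: every product of two adjacent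
    factors sends the tensor to zero. *)
Definition annihilated (f : seq mon -> k) : Prop := forall pre m suf,
  \sum_(kk : 'X_{1..n < (mdeg m).+1, (mdeg m).+1} | m == (kk.1 + kk.2)%MM)
    f (pre ++ [:: bmnm kk.1, bmnm kk.2 & suf]) = 0.

Definition supported (J : pred nat) (a : seq nat) (f : seq mon -> k) : Prop :=
  forall m s, f (m :: s) != 0 -> J (mdeg m) /\ map mdeg s = a.

(** The degree of the first factor is only constrained by J, because in
    R (x) S^D(V) that factor is the coefficient ring. *)
Definition ribbon_tensor J a p (x : tpow k n p) : Prop :=
  supported J a (cf x) /\ annihilated (cf x).

(** Exceeds the weight of every monomial whose degree is an entry of a. *)
Definition rank_base (a : seq nat) : nat := (n * sumn a).+2.

Lemma rank_base_digits a (s : seq mon) : map mdeg s = a ->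
  all (fun m => mnmwgt m < rank_base a)%N s.
Proof.
move=> <-; apply/allP => m ms; rewrite ltnS leqW //.
apply: leq_trans (mnmwgt_le m) _; rewrite leq_mul2l.
by rewrite sumnE (perm_big _ (perm_map mdeg (perm_to_rem ms))) big_cons leq_addr orbT.
Qed.

Lemma supported0 J a p : supported J a (cf (0 : tpow k n p)).
Proof. by move=> m s; rewrite cf0 eqxx. Qed.

Lemma supportedZD J a p c (x y : tpow k n p) :
  supported J a (cf x) -> supported J a (cf y) ->
  supported J a (cf (c *: x + y)).
Proof.
move=> sx sy m s; rewrite cfD cfZ.
case: (eqVneq (cf y (m :: s)) 0) => [->|/sy //].
case: (eqVneq (cf x (m :: s)) 0) => [->|/sx //].
by rewrite mulr0 addr0 eqxx.
Qed.

Lemma annihilated0 p : annihilated (cf (0 : tpow k n p)).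
Proof. by move=> pre m suf; rewrite big1 // => kk _; rewrite cf0. Qed.

Lemma annihilatedZD p c (x y : tpow k n p) :
  annihilated (cf x) -> annihilated (cf y) -> annihilated (cf (c *: x + y)).
Proof.
move=> ax ay pre m suf; under eq_bigr => kk _ do rewrite cfD cfZ.
by rewrite big_split /= -big_distrr /= ax ay mulr0 addr0.
Qed.

Lemma ribbon_tensor0 J a p : ribbon_tensor J a (0 : tpow k n p).
Proof. by split; [apply: supported0 | apply: annihilated0]. Qed.

Lemma ribbon_tensorZD J a p c (x y : tpow k n p) :
  ribbon_tensor J a x -> ribbon_tensor J a y -> ribbon_tensor J a (c *: x + y).
Proof.
by move=> [sx ax] [sy ay]; split; [apply: supportedZD | apply: annihilatedZD].
Qed.

Definition ribbon_vector a p (x : tpow k n p) : Prop :=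
  (forall s, cf x s != 0 -> map mdeg s = a) /\ annihilated (cf x).

Lemma ribbon_vector0 a p : ribbon_vector a (0 : tpow k n p).
Proof. by split=> [s|]; [rewrite cf0 eqxx | apply: annihilated0]. Qed.

Lemma ribbon_vectorZD a p c (x y : tpow k n p) :
  ribbon_vector a x -> ribbon_vector a y -> ribbon_vector a (c *: x + y).
Proof.
move=> [sx ax] [sy ay]; split=> [s|]; last exact: annihilatedZD.
rewrite cfD cfZ; case: (eqVneq (cf y s) 0) => [->|/sy //].
rewrite addr0; case: (eqVneq (cf x s) 0) => [->|/sx //].
by rewrite mulr0 eqxx.
Qed.

Lemma ribbon_vector_tensor c b p (x : tpow k n p) :
  ribbon_vector (c :: b) x -> ribbon_tensor (pred1 c) b x.
Proof. by move=> [sx ax]; split=> // m s /sx[<- <-] /=. Qed.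

(** At a pair u, v without descent the product of the two factors expresses the
    coefficient through those of the other factorizations of u v, all of which
    have a lower rank. *)
Lemma nonzero_descent J a B f (m : mon) s : (1 < B)%N ->
  supported J a f -> annihilated f -> f (m :: s) != 0 -> ~~ path (@desc n) m s ->
  exists m' s', f (m' :: s') != 0 /\ (rank B s' < rank B s)%N.
Proof.
move=> B1 sf af fs /not_path_desc[pre [u [v [suf [E nd]]]]].
have := af pre (u + v)%MM suf.
have ltu : (mdeg u < (mdeg (u + v)%MM).+1)%N by rewrite mdegD ltnS leq_addr.
have ltv : (mdeg v < (mdeg (u + v)%MM).+1)%N by rewrite mdegD ltnS leq_addl.
rewrite (bigD1 (BMultinom ltu, BMultinom ltv)) //= -E => /eqP.
rewrite addr_eq0 => /eqP fE.
have [kk /andP[/eqP kkE ne] nz] : exists2 kk :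
    'X_{1..n < (mdeg (u + v)%MM).+1, (mdeg (u + v)%MM).+1},
    ((u + v)%MM == (kk.1 + kk.2)%MM) && (kk != (BMultinom ltu, BMultinom ltv)) &
    f (pre ++ [:: bmnm kk.1, bmnm kk.2 & suf]) != 0.
  case: (pselect (exists2 kk :
    'X_{1..n < (mdeg (u + v)%MM).+1, (mdeg (u + v)%MM).+1},
    ((u + v)%MM == (kk.1 + kk.2)%MM) && (kk != (BMultinom ltu, BMultinom ltv)) &
    f (pre ++ [:: bmnm kk.1, bmnm kk.2 & suf]) != 0)) => // no.
  move: fs; rewrite fE big1 ?oppr0 ?eqxx // => kk hk; apply/eqP.
  by case: eqP => // /eqP nz; case: no; exists kk.
move: kk => [[u' lu] [v' lv]] /= in kkE ne nz *.
have vv' : v != v'.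
  apply: contraNneq ne => vv; rewrite -{}vv in lv kkE *.
  have uu : u = u' by move/(congr1 (fun w => (w - v)%MM)): kkE; rewrite !addmK.
  by rewrite -{}uu in lu *; apply/eqP; congr (_, _); apply: val_inj.
have dv : mdeg v = mdeg v'.
  have [_ s1] := sf _ _ fs.
  case: pre E nz {fE} => [|m0 pre] /= [E1 E2] /sf[_ s2].
    by move: s1; rewrite E2 -s2 => -[].
  move/eqP: s1; rewrite E2 -s2 !map_cat /= eqseq_cat // !eqseq_cons eqxx.
  by case/and4P => _ _ /eqP.
have lt := sorted_split_max nd kkE dv vv'.
case: pre E nz {fE} => [|m0 pre] /= [E1 E2] nz.
  by exists u', (v' :: suf); rewrite E2; split=> //; apply: rank_head.
exists m0, (pre ++ [:: u', v' & suf]); split=> //.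
by rewrite E2; apply: rank_exchange.
Qed.

(** The rank does not involve the first entry of the tuple, which is what allows
    its degree to be unbounded. *)
Definition leading (a : seq nat) (m : mon) s p (x : tpow k n p) : Prop :=
  cf x (m :: s) = 1 /\
  forall m' s', cf x (m' :: s') != 0 ->
    m' :: s' = m :: s \/ (rank (rank_base a) s < rank (rank_base a) s')%N.

(** Downward induction on the least rank in the support of x: the terms of that
    rank have descents everywhere, so subtracting the corresponding multiples
    of the given leading elements raises the least rank. *)
Lemma ribbon_generation (J : pred nat) (a : seq nat) p
    (Z : tpow k n p -> Prop) : (0 < p)%N ->
  Z 0 -> (forall c x y, Z x -> Z y -> Z (c *: x + y)) ->
  (forall (m : mon) s, J (mdeg m) -> map mdeg s = a -> path (@desc n) m s ->
     exists f, [/\ Z f, ribbon_tensor J a f & leading a m s f]) ->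
  forall x, ribbon_tensor J a x -> Z x.
Proof.
case: p Z => [//|p] Z _ Z0 ZD H.
pose good (t : mon * seq mon) :=
  [&& J (mdeg t.1), map mdeg t.2 == a & path (@desc n) t.1 t.2].
have /choice[F FP] : forall t, exists f : tpow k n p.+1,
    good t -> [/\ Z f, ribbon_tensor J a f & leading a t.1 t.2 f].
  move=> [m s]; case: (boolP (good (m, s))) => [/and3P[h1 /eqP h2 h3]|_]; last by exists 0.
  by have [f hf] := H m s h1 h2 h3; exists f.
set B := rank_base a.
suff main N (x : tpow k n p.+1) : ribbon_tensor J a x ->
    (forall m s, cf x (m :: s) != 0 -> (B ^ size a - N <= rank B s)%N) -> Z x.
  by move=> x cx; apply: (main (B ^ size a)%N) => // m s _; rewrite subnn.
elim: N x => [|N IH] x cx low.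
  have -> : x = 0 => //; apply: cf_eq0 => -[//|m s]; apply/eqP.
  apply/negP => /negP nz; have [_ da] := cx.1 _ _ nz.
  have := rank_bound (rank_base_digits da); rewrite -/B ltnNge.
  have -> : size s = size a by rewrite -da size_map.
  by have := low _ _ nz; rewrite subn0 => ->.
pose lev := (B ^ size a - N.+1)%N.
have [b bP] := slice_bound (x : tensor _ _).
pose L := [seq (bmnm m, s) | m <- enum {: 'X_{1..n < b}}, s <- tups n a].
have uL : uniq L.
  apply: allpairs_uniq; rewrite ?enum_uniq ?tups_uniq //.
  by move=> [m s] [m' s'] _ _ /= [/val_inj -> ->].
pose P t := good t && (rank B t.2 == lev).
pose y := \sum_(t <- L | P t) cf x (t.1 :: t.2) *: F t.
have Zy : Z y /\ ribbon_tensor J a y.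
  rewrite /y; elim/big_ind: _ => [|u v [Zu cu] [Zv cv]|t /andP[/FP[Zf cf _] _]].
  - by split=> //; apply: ribbon_tensor0.
  - by rewrite -[u]scale1r; split; [apply: ZD | apply: ribbon_tensorZD].
  - rewrite -[_ *: _]addr0; split; first exact: ZD.
    by apply: ribbon_tensorZD => //; apply: ribbon_tensor0.
have cy := ribbon_tensorZD (-1) Zy.2 cx.
rewrite -[x](addrNK y) addrC -[y in y + _]scale1r; apply: ZD; first by case: Zy.
rewrite addrC -scaleN1r; apply: IH cy _ => m s.
rewrite cfD cfZ mulN1r cf_sum addrC subr_eq0 => nz.
rewrite leqNgt; apply: contra nz => lt.
have le : (rank B s <= lev)%N.
  by move: lt; rewrite /lev subnS; case: (_ - _)%N.
have other t : t != (m, s) -> P t -> cf x (t.1 :: t.2) * cf (F t) (m :: s) = 0.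
  move=> ne /andP[/FP[_ _ [_ ld]] /eqP rt]; apply/eqP.
  case: (eqVneq (cf (F t) (m :: s)) 0) => [->|/ld[[e1 e2]|]]; first by rewrite mulr0.
    by case: t {ld rt} e1 e2 ne => ? ? /= <- <-; rewrite eqxx.
  by rewrite -/B rt ltnNge le.
under eq_bigr => t _ do rewrite cfZ.
case: (eqVneq (cf x (m :: s)) 0) => [x0|x0].
  rewrite x0 big1 // => t Pt; case: (eqVneq t (m, s)) => [->|/other -> //].
  by rewrite x0 mul0r.
have [Jm da] := cx.1 _ _ x0.
have rk : rank B s = lev by apply/eqP; rewrite eqn_leq le; exact: low x0.
have Pms : P (m, s).
  rewrite /P /good /= rk eqxx Jm da eqxx andbT /=.
  apply/negPn/negP => nd.
  have B1 : (1 < B)%N by [].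
  have [m' [s' [/low le' lt']]] := nonzero_descent B1 cx.1 cx.2 x0 nd.
  by move: lt'; rewrite rk ltnNge le'.
have Lms : (m, s) \in L.
  have mb : (mdeg m < b)%N.
    by rewrite ltnNge; apply: contra x0 => /bP /= ->; rewrite cf0.
  apply/allpairsP; exists (BMultinom mb, s); split=> //; first by rewrite mem_enum.
  by rewrite mem_tups da.
rewrite big_mkcond (bigD1_seq (m, s)) //= Pms big1 ?addr0; last first.
  by move=> t nt; case: ifP => // Pt; apply: other.
by case/andP: Pms => /FP[_ _ [/= -> _]] _; rewrite mulr1.
Qed.

End Ribbons.

(** * The cells of a ribbon and their fillings *)

Notation positive := (all (fun j : nat => (0 < j)%N)).

Section RibbonCells.

Fixpoint ribbon_rows (c : nat) (a : seq nat) : seq (seq (nat * nat)) :=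
  if a is m :: a' then
    [seq (size a', c + t)%N | t <- iota 0 m] :: ribbon_rows (c + m.-1) a'
  else [::].

Lemma ribbon_cells_row c a x : x \in ribbon_cells c a -> (x.1 < size a)%N.
Proof.
elim: a c => [//|m a IH] c /=; rewrite mem_cat => /orP[/mapP[t _ ->] //|/IH].
exact: ltnW.
Qed.

Lemma ribbon_cells_col c a x : x \in ribbon_cells c a -> (c <= x.2)%N.
Proof.
elim: a c => [//|m a IH] c /=; rewrite mem_cat.
case/orP=> [/mapP[t _ ->] /=|/IH]; first exact: leq_addr.
by apply: leq_trans; apply: leq_addr.
Qed.

Lemma ribbon_cells_uniq c a : uniq (ribbon_cells c a).
Proof.
elim: a c => [//|m a IH] c /=; rewrite cat_uniq IH andbT map_inj_uniq ?iota_uniq /=.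
  apply/hasPn => x /ribbon_cells_row lt; apply/mapP => -[t _ e].
  by rewrite e ltnn in lt.
by move=> t t' [/addnI].
Qed.

(** Rows are numbered downwards but listed from the bottom, hence the reversed
    enumeration. *)
Lemma ribbon_rowsE c a :
  [seq [seq x <- ribbon_cells c a | x.1 == i] | i <- rev (iota 0 (size a))]
    = ribbon_rows c a.
Proof.
elim: a c => [//|m a IH] c.
rewrite -[size _]addn1 iotaD add0n rev_cat [rev (iota _ 1)]/= map_cat /=; congr (_ :: _).
  rewrite filter_cat -[RHS]cats0; congr (_ ++ _).
    by apply/all_filterP; apply/allP => x /mapP[t _ ->] /=.
  apply/eqP; rewrite -size_eq0 size_filter -leqn0 leqNgt -has_count.
  apply/hasPn => x /ribbon_cells_row lt; apply: contraL lt => /eqP ->.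
  by rewrite ltnn.
rewrite -IH; apply/eq_in_map => i; rewrite mem_rev mem_iota add0n => /= lt.
rewrite filter_cat -[RHS]cat0s; congr (_ ++ _).
apply/eqP; rewrite -size_eq0 size_filter -leqn0 leqNgt -has_count.
by apply/hasPn => x /mapP[t _ ->] /=; rewrite gtn_eqF.
Qed.

Lemma ribbon_row_ex c a i : positive a -> (i < size a)%N ->
  exists2 x, x \in ribbon_cells c a & x.1 = i.
Proof.
elim: a c => [//|m a IH] c /= /andP[m0 pa].
rewrite ltnS leq_eqVlt => /orP[/eqP ->|lt].
  exists (size a, c + 0)%N => //; rewrite mem_cat; apply/orP; left.
  by apply/mapP; exists 0%N; rewrite // mem_iota.
by have [x hx xi] := IH (c + m.-1)%N pa lt; exists x; rewrite // mem_cat hx orbT.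
Qed.

Lemma mem_ribbon a x : (x \in ribbon a) = (x \in ribbon_cells 0 a).
Proof. by rewrite /ribbon !inE. Qed.

Lemma diag_rows_ribbon a : positive a ->
  diag_rows (ribbon a) = rev (iota 0 (size a)).
Proof.
move=> pa; apply: (@sorted_eq _ geq).
- by move=> x y z /= yx xz; apply: leq_trans xz yx.
- by move=> x y /= /andP[xy yx]; apply/eqP; rewrite eqn_leq xy yx.
- by apply: sort_sorted => x y; apply: leq_total.
- by rewrite rev_sorted; apply: iota_sorted.
rewrite /diag_rows perm_sort; apply: uniq_perm.
- exact: undup_uniq.
- by rewrite rev_uniq iota_uniq.
move=> i; rewrite mem_undup mem_rev mem_iota add0n /=.
apply/mapP/idP => [[x] |/(ribbon_row_ex 0 pa)[x hx <-]].
  by rewrite -[x \in _]/(x \in ribbon a) mem_ribbon => /ribbon_cells_row lt ->.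
by exists x => //; rewrite -[x \in _]/(x \in ribbon a) mem_ribbon.
Qed.

Lemma big_ribbon (R : Type) (idx : R) (op : Monoid.com_law idx) a
    (P : pred (nat * nat)) (F : nat * nat -> R) :
  \big[op/idx]_(c : ribbon a | P (val c)) F (val c) =
    \big[op/idx]_(x <- ribbon_cells 0 a | P x) F x.
Proof.
rewrite -big_seq_fsetE /=; apply: perm_big; apply: uniq_perm.
- exact: fset_uniq.
- exact: ribbon_cells_uniq.
- by move=> x; rewrite -mem_ribbon.
Qed.

Lemma ribbon_row_bigs (R : Type) (idx : R) (op : Monoid.com_law idx) a
    (F : nat * nat -> R) : positive a ->
  [seq \big[op/idx]_(c : ribbon a | (val c).1 == i) F (val c)
     | i <- diag_rows (ribbon a)] =
  [seq \big[op/idx]_(x <- row) F x | row <- ribbon_rows 0 a].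
Proof.
move=> pa; rewrite -ribbon_rowsE -map_comp diag_rows_ribbon //.
apply: eq_map => i /=; rewrite big_filter.
exact: (big_ribbon _ _ (fun x => x.1 == i)).
Qed.

Lemma ribbon_rows_size c a : map size (ribbon_rows c a) = a.
Proof. by elim: a c => [//|m a IH] c /=; rewrite size_map size_iota IH. Qed.

Lemma ribbon_row_card a : positive a ->
  [seq (\sum_(c : ribbon a | (val c).1 == i) 1)%N | i <- diag_rows (ribbon a)]
    = a.
Proof.
move=> pa; rewrite (ribbon_row_bigs _ (fun=> 1%N) pa) -[RHS](ribbon_rows_size 0).
by apply: eq_map => row; rewrite sum1_size.
Qed.

Lemma card_ribbon a : #|` ribbon a| = sumn a.
Proof.
have -> : #|` ribbon a| = size (ribbon_cells 0 a).
  apply: perm_size; apply: uniq_perm; first exact: fset_uniq.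
    exact: ribbon_cells_uniq.
  by move=> x; rewrite -mem_ribbon.
elim: a 0%N => [//|m a IH] c /=.
by rewrite size_cat size_map size_iota IH.
Qed.

Lemma ribbon_overlap c a i : positive a -> (i.+1 < size a)%N ->
  exists j, (i.+1, j) \in ribbon_cells c a /\ (i, j) \in ribbon_cells c a.
Proof.
elim: a c => [//|m a IH] c /= /andP[m0 pa].
rewrite ltnS leq_eqVlt => /orP[/eqP ia|lt].
  exists (c + m.-1)%N; rewrite !mem_cat; split; apply/orP.
    by left; apply/mapP; exists m.-1; rewrite ?ia ?mem_iota ?add0n ?ltn_predL.
  right; case: a ia pa {IH} => [//|m' a] [ia] /= /andP[m'0 _].
  rewrite mem_cat; apply/orP; left.
  by apply/mapP; exists 0%N; rewrite ?mem_iota ?addn0 ?ia.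
have [j [h1 h2]] := IH (c + m.-1)%N pa lt.
by exists j; rewrite !mem_cat h1 h2 !orbT.
Qed.

End RibbonCells.

Section Filling.
Variables (n : nat) (x0 : 'I_n).
Local Notation mon := 'X_{1..n}.
Implicit Types (m : mon) (s : seq mon).

Definition letters m : seq 'I_n :=
  sort (fun i j : 'I_n => i <= j)%N (flatten [seq nseq (m i) i | i <- enum 'I_n]).

Lemma mem_letters m i : (i \in letters m) = (0 < m i)%N.
Proof.
rewrite mem_sort; apply/flattenP/idP => [[s /mapP[j _ ->]]|mi].
  by rewrite mem_nseq => /andP[mj /eqP ->].
by exists (nseq (m i) i); [apply: map_f; rewrite mem_enum | rewrite mem_nseq mi eqxx].
Qed.

Lemma size_letters m : size (letters m) = mdeg m.
Proof.
rewrite size_sort size_flatten /shape -map_comp sumnE big_map mdegE big_enum.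
by apply: eq_bigr => i _; rewrite /= size_nseq.
Qed.

Lemma letters_sum m : (\sum_(i <- letters m) U_(i))%MM = m.
Proof.
rewrite (perm_big (flatten [seq nseq (m i) i | i <- enum 'I_n])); last by rewrite perm_sort.
rewrite big_flatten big_map /=; apply/mnmP => j.
rewrite mnm_sumE /= big_enum (bigD1 j) //=.
rewrite mnm_sumE big_nseq mnm1E eqxx iter_addn mul1n addn0 big1 ?addn0 // => i ij.
rewrite mnm_sumE big_nseq mnm1E (negPf ij).
by rewrite iter_addn mul0n.
Qed.

Lemma letters_sorted m i j : (i <= j)%N -> (j < mdeg m)%N ->
  (nth x0 (letters m) i <= nth x0 (letters m) j)%N.
Proof.
move=> ij jm; apply: (@sorted_leq_nth _ (fun i j : 'I_n => i <= j)%N) => //.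
- by move=> a b c; apply: leq_trans.
- by apply: sort_sorted => a b; apply: leq_total.
- by rewrite inE size_letters (leq_ltn_trans ij).
- by rewrite inE size_letters.
Qed.

Lemma desc_letters (u v : mon) : desc u v ->
  (nth x0 (letters v) 0 < nth x0 (letters u) (mdeg u).-1)%N.
Proof.
move=> /descP[i [j [ji]]]; rewrite -!mem_letters.
move=> /(nthP x0)[a]; rewrite size_letters => au ia.
move=> /(nthP x0)[b]; rewrite size_letters => bv jb.
rewrite -{}ia -{}jb in ji; apply: leq_ltn_trans (leq_trans ji _).
  exact: letters_sorted.
by apply: letters_sorted; case: (mdeg u) au.
Qed.

(** Each row of the ribbon receives the letters of one monomial in increasing
    order; c is the column of the first cell. *)
Fixpoint fill (c : nat) s (x : nat * nat) : 'I_n :=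
  if s is m :: s' then
    if x.1 == size s' then nth x0 (letters m) (x.2 - c)
    else fill (c + (mdeg m).-1) s' x
  else x0.

Lemma fill_rows c s :
  [seq (\sum_(x <- row) U_(fill c s x))%MM | row <- ribbon_rows c (map mdeg s)]
    = s.
Proof.
elim: s c => [//|m s IH] c; rewrite /= size_map; congr (_ :: _).
  rewrite big_map /= -[RHS]letters_sum (big_nth x0) size_letters /index_iota subn0.
  by apply: eq_bigr => t _; rewrite eqxx addKn.
rewrite -[RHS](IH (c + (mdeg m).-1)%N) -ribbon_rowsE -!map_comp size_map.
apply/eq_in_map => i; rewrite mem_rev mem_iota add0n => /= lt.
apply: eq_big_seq => x; rewrite mem_filter => /andP[/eqP -> _].
by rewrite ltn_eqF.
Qed.

(** Consecutive rows only meet in the last cell of the lower one and the first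
    cell of the upper one, where the descent makes the column strict.  The first
    conclusion is what the induction needs when a row has a single cell, so
    that a column goes through more than two rows. *)
Lemma fill_columns c m s : positive (map mdeg (m :: s)) -> path (@desc n) m s ->
  let cells := ribbon_cells c (map mdeg (m :: s)) in
  (forall x, x \in cells -> x.2 = c ->
     fill c (m :: s) x <= nth x0 (letters m) 0)%N /\
  (forall x y, x \in cells -> y \in cells -> x.2 = y.2 -> (x.1 < y.1)%N ->
     (fill c (m :: s) x < fill c (m :: s) y)%N).
Proof.
elim: s c m => [|m' s IH] c m.
  move=> _ _ /=; rewrite cats0; split.
    by move=> _ /mapP[t _ ->] /= e; rewrite e subnn.
  by move=> _ _ /mapP[t _ ->] /mapP[t' _ ->] /=; rewrite ltnn.
move=> /= /andP[m0 pos] /andP[mm' pa].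
have [IH1 IH2] := IH (c + (mdeg m).-1)%N m' pos pa.
pose c' := (c + (mdeg m).-1)%N; rewrite -/c'.
have restP x : x \in ribbon_cells c' (map mdeg (m' :: s)) ->
    (x.1 == (size s).+1) = false /\ (c' <= x.2)%N.
  move=> hx; have := ribbon_cells_row hx; rewrite /= size_map => lt.
  by split; [rewrite ltn_eqF | apply: ribbon_cells_col hx].
have last_m x : x \in ribbon_cells c' (map mdeg (m' :: s)) -> x.2 = c' ->
    (fill c' (m' :: s) x < nth x0 (letters m) (mdeg m).-1)%N.
  by move=> hx e; apply: leq_ltn_trans (IH1 x hx e) (desc_letters mm').
split=> [x|x y].
  rewrite mem_cat => /orP[/mapP[t _ ->]|hx] /=.
    by rewrite /= size_map eqxx => ->; rewrite subnn.
  have [-> c'x] := restP x hx => e; have cc' : c' = c.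
    by apply/eqP; rewrite eqn_leq -{1}e c'x leq_addr.
  have m1 : (mdeg m).-1 = 0%N by apply: (@addnI c); rewrite addn0.
  by have := last_m x hx; rewrite m1 cc' => /(_ e) /ltnW.
rewrite (mem_cat x) (mem_cat y) => /orP[/mapP[t _ ->]|hx] /orP[/mapP[t' ht' ->]|hy] /=.
- by rewrite ltnn.
- have := @ribbon_cells_row c' (map mdeg (m' :: s)) y hy; rewrite /= => lt _ /(ltn_trans lt).
  by rewrite ltnn.
- have [-> c'x] := restP x hx; rewrite size_map eqxx => e _.
  have et : t' = (mdeg m).-1.
    apply/eqP; rewrite eqn_leq; move: c'x; rewrite e leq_add2l => ->.
    by move: ht'; rewrite mem_iota add0n andbT /= => ht'; rewrite -ltnS prednK.
  by rewrite addKn et; apply: last_m => //; rewrite e et.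
have [-> _] := restP x hx; have [-> _] := restP y hy.
exact: IH2.
Qed.

End Filling.

(** * The generators of the Schur functor of a ribbon *)

Section SchurGenerators.
Variables (k : comNzRingType) (n : nat).
Local Notation S := {mpoly k[n]}.
Local Notation mon := 'X_{1..n}.

(** Pairing w with u * w instead of comparing the sum with its opposite keeps
    the statement true when 2 is a zero divisor. *)
Lemma signed_sum_eq0 (T : finType) (P : pred {perm T}) (H : {perm T} -> k)
    (u : {perm T}) : odd_perm u ->
  (forall w, P (u * w)%g = P w) -> (forall w, H (u * w)%g = H w) ->
  \sum_(w | P w) (-1) ^+ w * H w = 0.
Proof.
move=> ou Pu Hu; rewrite (bigID (@odd_perm T)) /=.
rewrite [X in _ + X](reindex_inj (mulgI u)) /=.
rewrite [X in _ + X](eq_big (fun w => P w && odd_perm w)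
  (fun w : {perm T} => - ((-1) ^+ w * H w))).
- by rewrite sumrN subrr.
- by move=> w; rewrite Pu odd_permM ou; case: (odd_perm w).
move=> w /andP[_]; rewrite Hu odd_permM ou; case: (odd_perm w) => //= _.
by rewrite expr0 expr1 mulN1r mul1r opprK.
Qed.

Lemma prod_neq0_in (I : eqType) (r : seq I) (F : I -> k) :
  \prod_(i <- r) F i != 0 -> forall i, i \in r -> F i != 0.
Proof.
move=> nz i ir; apply: contraNneq nz => Fi.
by rewrite (big_rem i) //= Fi mul0r.
Qed.

Lemma map_mdeg_zip (rs : seq nat) (s : seq mon) (f : nat -> nat) :
  size s = size rs -> (forall im, im \in zip rs s -> mdeg im.2 = f im.1) ->
  map mdeg s = map f rs.
Proof.
elim: rs s => [|i rs IH] [|m s] //= [e] H.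
rewrite (H (i, m)) ?mem_head // IH // => im h; apply: H.
by rewrite in_cons h orbT.
Qed.

Lemma mem_zipl (I T : eqType) (s : seq I) (t : seq T) x :
  x \in zip s t -> x.1 \in s.
Proof.
elim: s t => [|i s IH] [|y t] //=; rewrite !in_cons => /orP[/eqP ->|/IH ->] /=.
  by rewrite eqxx.
by rewrite orbT.
Qed.

Lemma rev_iota_split p j : rev (iota 0 (p + j)) = rev (iota j p) ++ rev (iota 0 j).
Proof. by rewrite addnC iotaD rev_cat. Qed.

Lemma rev_iotaSS j : rev (iota 0 j.+2) = [:: j.+1, j & rev (iota 0 j)].
Proof. by rewrite (rev_iota_split 2 j). Qed.

Section Ribbon.
Variable a : seq nat.
Hypothesis pa : positive a.
Local Notation D := (ribbon a).
Local Notation row c := (val c).1.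
Local Notation col c := (val c).2.

Let rows_size : size (diag_rows D) = size a.
Proof. by rewrite diag_rows_ribbon // size_rev size_iota. Qed.

Section Generator.
Variable v : D -> 'cV[k]_n.

Definition row_prod (w : {perm D}) (i : nat) : S :=
  \prod_(c : D | row c == i) lin_form (v (w c)).

Lemma cf_schur_gen s : cf (schur_gen v) s =
  \sum_(w : {perm D} | [forall c, col (w c) == col c]) (-1) ^+ w *
    (if size s == size a then
       \prod_(im <- zip (rev (iota 0 (size a))) s) (row_prod w im.1)@_(im.2)
     else 0).
Proof.
rewrite /schur_gen cf_sum; apply: eq_bigr => w _.
by rewrite cfZ cf_ptens rows_size diag_rows_ribbon.
Qed.

Lemma schur_gen_degrees s : cf (schur_gen v) s != 0 -> map mdeg s = a.
Proof.
rewrite cf_schur_gen => nz.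
have [w nw] : exists w : {perm D}, (if size s == size a then
    \prod_(im <- zip (rev (iota 0 (size a))) s) (row_prod w im.1)@_(im.2)
     else 0) != 0.
  case: (pselect (exists w : {perm D}, (if size s == size a then
    \prod_(im <- zip (rev (iota 0 (size a))) s) (row_prod w im.1)@_(im.2)
     else 0) != 0)) => // no.
  case/eqP: nz; rewrite big1 // => w _; apply/eqP; apply/negPn/negP => nw.
  case: no; exists w; apply: contraNneq nw => ->.
  by rewrite mulr0.
move: nw; case: (eqVneq (size s) (size a)) => [es|_]; last by rewrite eqxx.
move/prod_neq0_in => nz'.
rewrite -[RHS](ribbon_row_card pa) diag_rows_ribbon //; apply: map_mdeg_zip.
  by rewrite size_rev size_iota.
move=> im /nz'; rewrite -mcoeff_msupp.
suff /dhomog_mf H : row_prod w im.1 \is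
    (\sum_(c : D | row c == im.1) 1)%N.-homog by move/H.
rewrite /row_prod; elim/big_ind2: _ => [|x e y f hx hf|c _].
- exact: dhomog1.
- exact: dhomogM.
- exact: lin_form_homog.
Qed.

(** Two adjacent rows share a column; transposing their two cells in it changes
    the sign of a column permutation but not the product of the two rows. *)
Lemma schur_gen_annihilated : annihilated (cf (schur_gen v)).
Proof.
move=> pre m suf; under eq_bigr => kk _ do rewrite cf_schur_gen.
have [sz|/negPf sz] := eqVneq (size pre + (size suf).+2)%N (size a); last first.
  rewrite big1 // => kk _; rewrite big1 // => w _.
  by rewrite size_cat /= sz mulr0.
rewrite exchange_big /=.
pose j := size suf.
pose A w := \prod_(im <- zip (rev (iota j.+2 (size pre))) pre) (row_prod w im.1)@_(im.2).
pose C w := \prod_(im <- zip (rev (iota 0 j)) suf) (row_prod w im.1)@_(im.2).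
pose H w := A w * (row_prod w j.+1 * row_prod w j)@_m * C w.
have jl : (j.+1 < size a)%N by rewrite -sz; apply: leq_addl.
transitivity (\sum_(w : {perm D} | [forall c, col (w c) == col c]) (-1) ^+ w * H w).
  apply: eq_bigr => w _; rewrite /H mcoeffM -big_distrr /=; congr (_ * _).
  rewrite big_distrr big_distrl /=; apply: eq_bigr => kk _.
  rewrite size_cat /= sz eqxx -sz rev_iota_split rev_iotaSS zip_cat; last first.
    by rewrite size_rev size_iota.
  rewrite big_cat /= -mulrA; congr (_ * _).
  by rewrite !big_cons /= mulrA.
have [y [h1 h2]] := ribbon_overlap 0 pa jl.
rewrite -!mem_ribbon in h1 h2.
pose c1 : D := [` h1]%fset; pose c2 : D := [` h2]%fset.
have c12 : c1 != c2.
  by apply/eqP => /(congr1 val) [] /eqP; rewrite -[X in _ == X]addn0 -addn1 eqn_add2l.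
have row_fix i w : i != j -> i != j.+1 -> row_prod (tperm c1 c2 * w)%g i = row_prod w i.
  move=> ij ij1; apply: eq_bigr => c /eqP ci; rewrite permM tpermD //.
    by apply: contraNneq ij1 => e; rewrite -ci -e.
  by apply: contraNneq ij => e; rewrite -ci -e.
have col_t c : col (tperm c1 c2 c) = col c by case: tpermP => [->|->|].
have fused w : row_prod w j.+1 * row_prod w j =
    \prod_(c : D | (row c == j.+1) || (row c == j)) lin_form (v (w c)).
  rewrite [RHS](bigID (fun c : D => row c == j.+1)) /=; congr (_ * _); apply: eq_bigl => c.
    by case: (row c == _); rewrite ?andbF.
  case: (row c =P j.+1) => [->|_]; last by rewrite andbT.
  by rewrite /= eqn_leq ltnn.
apply: (signed_sum_eq0 (u := tperm c1 c2)).
- by rewrite odd_tperm.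
- move=> w; apply/forallP/forallP => hw c.
    by have := hw (tperm c1 c2 c); rewrite permM tpermK col_t.
  by rewrite permM -(col_t c).
move=> w; rewrite /H; congr (_ * _ * _).
- rewrite /A; apply: eq_big_seq => im /mem_zipl; rewrite mem_rev mem_iota => /andP[ji _].
  by rewrite row_fix // neq_ltn ?ji ?orbT // (ltnW ji) orbT.
- rewrite !fused (reindex_inj (@perm_inj _ (tperm c1 c2))) /=; congr (_@_m).
  apply: eq_big => c; last by rewrite permM tpermK.
  by case: tpermP => [->|->|_ _ //]; rewrite /= !eqxx !orbT.
- rewrite /C; apply: eq_big_seq => im /mem_zipl; rewrite mem_rev mem_iota add0n /= => ij.
  by rewrite row_fix // neq_ltn ?ij ?ltnS ?(ltnW ij).
Qed.

End Generator.

End Ribbon.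

Section LeadingTerm.
Variables (x0 : 'I_n) (m : mon) (s : seq mon).
Hypothesis desc_ms : path (@desc n) m s.
Let a := map mdeg (m :: s).
Hypothesis pa : positive a.
Local Notation D := (ribbon a).
Local Notation row c := (val c).1.
Local Notation col c := (val c).2.
Let T (c : D) : 'I_n := fill x0 0 (m :: s) (val c).

Definition row_mon (w : {perm D}) (i : nat) : mon :=
  (\sum_(c : D | row c == i) U_(T (w c)))%MM.

Definition fill_gen : tpow k n (size (diag_rows D)) :=
  schur_gen (fun c => delta_mx (T c) 0).

Lemma cf_fill_gen t : cf fill_gen t =
  \sum_(w : {perm D} | [forall c, col (w c) == col c]) (-1) ^+ w *
     (t == [seq row_mon w i | i <- rev (iota 0 (size a))])%:R.
Proof.
rewrite cf_schur_gen //; apply: eq_bigr => w _; congr (_ * _).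
have rowE i : row_prod (fun c => delta_mx (T c) 0) w i = 'X_[row_mon w i] :> S.
  rewrite /row_prod (big_morph _ (@mpolyXD n k) (mpolyX0 n k)); apply: eq_bigr => c _.
  rewrite /lin_form (bigD1 (T (w c))) //= mxE !eqxx scale1r big1 ?addr0 //.
  by move=> j ne; rewrite mxE (negPf ne) scale0r.
have e : size a = size (rev (iota 0 (size a))) by rewrite size_rev size_iota.
rewrite {1}e; elim: (rev _) t => [|i r IH] [|t0 t] //=.
  by rewrite big_nil.
rewrite eqSS eqseq_cons -mulnb natrM -IH; case: eqP => _; last by rewrite mulr0.
by rewrite big_cons /= rowE mcoeffX eq_sym.
Qed.

Lemma row_mon1 : [seq row_mon 1%g i | i <- rev (iota 0 (size a))] = m :: s.
Proof.
rewrite -[RHS](fill_rows x0 0) -(ribbon_row_bigs _ (fun x => U_(fill x0 0 (m :: s) x))%MM pa).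
rewrite diag_rows_ribbon //; apply: eq_map => i; apply: eq_bigr => c _.
by rewrite perm1.
Qed.

(** The highest row that w changes receives letters from lower cells of the
    same columns, and columns increase downwards.  That row is never the bottom
    one, whose entry the rank ignores. *)
Lemma row_mon_raise (w : {perm D}) :
  [forall c, col (w c) == col c] -> w != 1%g ->
  (rank (rank_base n (behead a)) s <
   rank (rank_base n (behead a)) (behead [seq row_mon w i | i <- rev (iota 0 (size a))]))%N.
Proof.
move=> /forallP hw w1.
have [c' wc'] : exists c, w c != c.
  apply/existsP; apply: contraNT w1 => /existsPn w1.
  by apply/eqP/permP => c; rewrite perm1; apply/eqP; have := w1 c; rewrite negbK.
case: (@arg_minnP _ c' (fun c => w c != c) (fun c => row c) wc') => c0 wc0 c0min.
have cells (c : D) : val c \in ribbon_cells 0 a by rewrite -mem_ribbon; apply: valP.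
have [_ cols] := fill_columns x0 0 pa desc_ms.
(* w fixes the cells of the rows above, so no cell of this row moves up *)
have down c : row c = row c0 -> w c != c -> (row c < row (w c))%N.
  move=> rc wc; rewrite ltn_neqAle; apply/andP; split; last first.
    by rewrite rc; apply: c0min; rewrite (inj_eq perm_inj).
  apply: contra wc => /eqP e; apply/eqP/val_inj/eqP.
  by rewrite -pair_eqE /= /pair_eq (eqP (hw c)) -e !eqxx.
have raise c : row c = row c0 -> w c != c -> (T c < T (w c))%N.
  by move=> rc wc; apply: cols; rewrite ?(eqP (hw c)) //; apply: down.
have fixed c : (row c < row c0)%N -> w c = c.
  by move=> lt; apply/eqP; apply: contraTT lt => /c0min; rewrite -leqNgt.
set i0 := row c0 in c0min down raise fixed.
have i0a : (i0.+1 < size a)%N.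
  apply: leq_trans (ribbon_cells_row (cells (w c0))).
  by rewrite ltnS; apply: down.
have [p ap] : exists p, size a = (p.+1 + i0.+1)%N.
  by exists (size a - i0.+2)%N; rewrite addSnnS subnK.
have rowsE w' : behead [seq row_mon w' i | i <- rev (iota 0 (size a))] =
    [seq row_mon w' i | i <- rev (iota i0.+1 p)] ++
      row_mon w' i0 :: [seq row_mon w' i | i <- rev (iota 0 i0)].
  have r1 : rev (iota 0 i0.+1) = i0 :: rev (iota 0 i0) := rev_iota_split 1 i0.
  have r2 : rev (iota i0.+1 p.+1) = (i0.+1 + p)%N :: rev (iota i0.+1 p).
    by rewrite -[p.+1]addn1 iotaD rev_cat.
  by rewrite ap rev_iota_split r1 r2 /= map_cat.
have sE : s = behead (m :: s) by [].
rewrite {1}sE -row_mon1 !rowsE; apply: rank_top.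
- by rewrite !size_map.
- have := rank_base_digits (erefl (map mdeg s)).
  by rewrite [X in all _ X]sE -row_mon1 rowsE all_cat => /andP[].
have -> : [seq row_mon w i | i <- rev (iota 0 i0)] =
          [seq row_mon 1%g i | i <- rev (iota 0 i0)].
  apply/eq_in_map => i; rewrite mem_rev mem_iota add0n => /= lt.
  by apply: eq_bigr => c /eqP ci; rewrite perm1 fixed // ci.
apply: rank_head.
have wtE w' : mnmwgt (row_mon w' i0) = (\sum_(c : D | row c == i0) (T (w' c)).+1)%N.
  rewrite (big_morph mnmwgt (@mnmwgtD _) (@mnmwgt0 _)).
  by apply: eq_bigr => c _; rewrite mnmwgt1.
rewrite !wtE (bigD1 c0) //= [ltnRHS](bigD1 c0) //= -addSn leq_add //.
  by rewrite perm1 ltnS raise.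
apply: leq_sum => c /andP[/eqP ci _]; rewrite perm1 ltnS.
by case: (eqVneq (w c) c) => [->//|/(raise _ ci)/ltnW].
Qed.

Lemma fill_gen_leading : leading (behead a) m s fill_gen.
Proof.
split.
  rewrite cf_fill_gen (bigD1 1%g) /=; last by apply/forallP => c; rewrite perm1.
  rewrite row_mon1 eqxx odd_perm1 expr0 mulr1 big1 ?addr0 // => w /andP[hw w1].
  case: eqP => [e|]; last by rewrite mulr0.
  by have := row_mon_raise hw w1; rewrite -e ltnn.
move=> m' s'; rewrite cf_fill_gen => nz.
case: (pselect (exists w : {perm D}, [forall c, col (w c) == col c] /\
    m' :: s' = [seq row_mon w i | i <- rev (iota 0 (size a))])) => [[w [hw e]]|no].
  case: (eqVneq w 1%g) => [w1|w1]; first by left; rewrite e w1 row_mon1.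
  by right; have := row_mon_raise hw w1; rewrite -e.
case/eqP: nz; rewrite big1 // => w hw; case: eqP => [e|]; last by rewrite mulr0.
by case: no; exists w.
Qed.

End LeadingTerm.

Lemma schur_ribbon_vector a (x : tpow k n _) : positive a ->
  x \in schur_pred (D := ribbon a) -> ribbon_vector a x.
Proof.
move=> pa /asboolP; elim=> [|c u y [v ->] _ IH]; first exact: ribbon_vector0.
apply: ribbon_vectorZD IH; split; last exact: schur_gen_annihilated.
by move=> s /(schur_gen_degrees pa).
Qed.

End SchurGenerators.

(** * Bases of the Schur functor and of its base change *)

Section SchurBasis.
Variables (k : comNzRingType) (n : nat).
Local Notation S := {mpoly k[n]}.
Local Notation mon := 'X_{1..n}.

Fact schur_val_linear D : linear (@schur_val k n D).
Proof. by []. Qed.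

HB.instance Definition _ D := GRing.isLinear.Build k _ _ _ (@schur_val k n D)
  (@schur_val_linear D).

Lemma schur_val_sum D (I : Type) (r : seq I) P (F : I -> schur k n D) :
  schur_val (\sum_(i <- r | P i) F i) = \sum_(i <- r | P i) schur_val (F i).
Proof. exact: linear_sum. Qed.

Lemma schur_leading a (m : mon) s : map mdeg (m :: s) = a -> positive a ->
  path (@desc n) m s ->
  exists x : schur k n (ribbon a), leading (behead a) m s (schur_val x).
Proof.
move=> <- pa pms; have [x0 _] : exists x0 : 'I_n, true.
  case: (boolP [exists x0 : 'I_n, true]) => [/existsP //|/existsPn no].
  by case/andP: pa; rewrite mdegE big1 // => i; have := no i.
have gen : fill_gen k x0 m s \in schur_pred (D := ribbon (map mdeg (m :: s))).
  by apply/asboolP/lspan_gen; eexists.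
exists (Defs.Schur gen); exact: fill_gen_leading.
Qed.

Lemma schur_ribbon_size a : positive a -> size (diag_rows (ribbon a)) = size a.
Proof. by move=> pa; rewrite diag_rows_ribbon // size_rev size_iota. Qed.

(** With [schur_ribbon_vector], the Schur functor of a ribbon is the module of
    the tensors killed by all adjacent products. *)
Lemma ribbon_vector_schur a (x : tpow k n _) : positive a -> (0 < size a)%N ->
  ribbon_vector a x -> x \in schur_pred (D := ribbon a).
Proof.
case: a x => [//|d a] x pa _ /ribbon_vector_tensor; move: x; apply: ribbon_generation.
- by rewrite schur_ribbon_size.
- exact: rpred0.
- by move=> c x y hx hy; rewrite rpredD // rpredZ.
move=> m s /eqP dm da pms.
have [|x lx] := @schur_leading (d :: a) m s _ pa pms; first by rewrite /= dm da.
exists (schur_val x); split=> //; first exact: schur_valP.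
exact: ribbon_vector_tensor (schur_ribbon_vector pa (schur_valP x)).
Qed.

Lemma schur_basis a : positive a -> (0 < size a)%N ->
  exists (q : nat) (e : 'I_q -> schur k n (ribbon a)), is_basis e.
Proof.
case: a => [//|d a] pa _; pose L := [seq t <- tups n (d :: a) | sorted (@desc n) t].
have uL : uniq L by rewrite filter_uniq // tups_uniq.
have LP t : t \in L -> exists m s, [/\ t = m :: s, map mdeg (m :: s) = d :: a &
    path (@desc n) m s].
  rewrite mem_filter mem_tups; case: t => [|m s] /andP[//= pms /eqP E].
  by exists m, s.
have /choice[E EP] : forall t, exists x : schur k n (ribbon (d :: a)),
    t \in L -> leading a (head 0%MM t) (behead t) (schur_val x).
  move=> t; case: (boolP (t \in L)) => [/LP[m [s [-> E pms]]]|_]; last by exists 0.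
  by have [x lx] := schur_leading E pa pms; exists x.
pose t (l : 'I_(size L)) := nth [::] L l.
have tL l : t l \in L by rewrite mem_nth.
have tE l : head 0%MM (t l) :: behead (t l) = t l.
  by have [m [s [-> _ _]]] := LP _ (tL l).
pose e l := E (t l); exists (size L), e.
have free (c : {ffun 'I_(size L) -> k}) : \sum_l c l *: e l = 0 -> c = 0.
  move=> c0; apply/ffunP => l; rewrite ffunE; apply/eqP/negPn/negP => cl.
  pose rk l := rank (rank_base n a) (behead (t l)).
  case: (@arg_minnP _ l (fun l => c l != 0) rk cl) => l0 cl0 lmin.
  case/eqP: cl0; have := congr1 (fun x => cf (schur_val x) (t l0)) c0.
  rewrite cf0 schur_val_sum cf_sum (bigD1 l0) //= => <-.
  have [e1 _] := EP _ (tL l0); rewrite tE in e1.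
  rewrite cfZ e1 mulr1 big1 ?addr0 // => l' l'l; apply/eqP.
  rewrite cfZ; case: (eqVneq (c l') 0) => [->|cl']; first by rewrite mul0r.
  case: (eqVneq (cf (schur_val (e l')) (t l0)) 0) => [->|]; first by rewrite mulr0.
  have [_ e2] := EP _ (tL l'); rewrite -{1}(tE l0) => /e2[|]; rewrite ?tE.
    by move/eqP; rewrite nth_uniq // => /eqP/val_inj ll; rewrite ll eqxx in l'l.
  by rewrite ltnNge lmin.
have span (x : schur k n (ribbon (d :: a))) :
    exists c : {ffun 'I_(size L) -> k}, x = \sum_l c l *: e l.
  suff H : forall y : tpow k n _, ribbon_tensor (pred1 d) a y ->
      exists c : {ffun 'I_(size L) -> k}, y = \sum_l c l *: schur_val (e l).
    have [c xE] := H _ (ribbon_vector_tensor (schur_ribbon_vector pa (schur_valP x))).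
    exists c; apply: val_inj; rewrite [LHS]xE -[RHS]/(schur_val _).
    by rewrite schur_val_sum.
  apply: ribbon_generation.
  - by rewrite schur_ribbon_size.
  - by exists 0; rewrite big1 // => l _; rewrite ffunE scale0r.
  - move=> c y z [cy ->] [cz ->]; exists [ffun l => c * cy l + cz l].
    rewrite scaler_sumr -big_split; apply: eq_bigr => l _.
    by rewrite ffunE scalerDl scalerA.
  move=> m s /eqP dm da pms.
  have msL : m :: s \in L by rewrite mem_filter mem_tups /= dm da pms eqxx.
  exists (schur_val (E (m :: s))); split; last exact: EP.
    have ltl : (index (m :: s) L < size L)%N by rewrite index_mem.
    exists [ffun l => (l == Ordinal ltl)%:R].
    rewrite (bigD1 (Ordinal ltl)) //= ffunE eqxx scale1r big1 ?addr0.
      by rewrite /e /t /= nth_index.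
    by move=> l /negPf ne; rewrite ffunE ne scale0r.
  exact: ribbon_vector_tensor (schur_ribbon_vector pa (schur_valP _)).
move=> x; have [c xE] := span x; exists c; split=> // c' xE'.
apply/eqP; rewrite -subr_eq0; apply/eqP/free.
under eq_bigr => l _ do rewrite !ffunE scalerBl.
by rewrite sumrB -xE -xE' subrr.
Qed.

End SchurBasis.

Section BaseChangeBasis.
Variables (k : comNzRingType) (A : algType k) (N : lmodType k).
Variables (q : nat) (e : 'I_q -> N).

Definition bc_basis (l : 'I_q) : base_change A N := tens 1 (e l).

Lemma bc_scaleE (a b : A) (y : N) :
  a *: (tens b y : base_change A N) = tens (a * b) y.
Proof. exact: bc_scale_tens. Qed.

Lemma bc_basisP : is_basis e -> is_basis bc_basis.
Proof.
move=> be.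
have /choice[C CP] : forall y, exists c : {ffun 'I_q -> k}, y = \sum_l c l *: e l.
  by move=> y; have [c [yE _]] := be y; exists c.
have CU y (c : {ffun 'I_q -> k}) : y = \sum_l c l *: e l -> C y = c.
  by move=> yE; have [c' [_ u]] := be y; rewrite -(u _ yE) -(u _ (CP y)).
have CZD c y z : C (c *: y + z) = [ffun l => c * C y l + C z l].
  apply: CU; rewrite {1}(CP y) {1}(CP z) scaler_sumr -big_split /=.
  apply: eq_bigr => l _.
  rewrite ffunE scalerDl scalerA; by [].
have bil l : bilinear_map (fun (a : A) (y : N) => C y l *: a).
  split=> [y c a b|a c y z]; first by rewrite scalerDr !scalerA mulrC.
  by rewrite CZD ffunE scalerDl scalerA.
pose f l := tens_lift (fun (a : A) (y : N) => C y l *: a).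
have fD l x y : f l (x + y) = f l x + f l y.
  by have := tens_lift_linear (bil l) 1 x y; rewrite !scale1r.
have f0 l : f l 0 = 0 by apply: (@addrI _ (f l 0)); rewrite -fD !addr0.
have fe l a j : f l (a *: bc_basis j) = (l == j)%:R *: a.
  rewrite bc_scaleE mulr1 /f tens_liftE //.
  rewrite (CU _ [ffun i => (i == j)%:R]) ?ffunE //.
  rewrite (bigD1 j) //= ffunE eqxx scale1r big1 ?addr0 // => i /negPf ij.
  by rewrite ffunE ij scale0r.
move=> x; have [c xE] : exists c : {ffun 'I_q -> A}, x = \sum_l c l *: bc_basis l.
  elim/tens_ind: x => [|a y u [c ->]].
    by exists 0; rewrite big1 // => l _; rewrite ffunE scale0r.
  exists [ffun l => C y l *: a + c l].
  under [RHS]eq_bigr => l _ do rewrite ffunE scalerDl.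
  rewrite big_split /=; congr (_ + _).
  rewrite {1}(CP y); elim/big_rec2: _ => [|l z1 z2 _ <-].
    by rewrite tens0r.
  by rewrite tensDr tensZr -tensZl [in RHS]bc_scaleE mulr1.
exists c; split=> // c' xE'; apply/ffunP => l.
have fx (c0 : {ffun 'I_q -> A}) : f l (\sum_j c0 j *: bc_basis j) = c0 l.
  rewrite (big_morph (f l) (fD l) (f0 l)) (bigD1 l) //= fe eqxx scale1r.
  by rewrite big1 ?addr0 // => j jl; rewrite fe eq_sym (negPf jl) scale0r.
by rewrite -(fx c) -(fx c') -xE -xE'.
Qed.

End BaseChangeBasis.

(** * The free modules as modules of tensors *)

Section FuseRibbon.
Variables (k : comNzRingType) (n : nat).
Local Notation S := {mpoly k[n]}.
Local Notation mon := 'X_{1..n}.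

(** Killed by all adjacent products except possibly the first one. *)
Definition tail_ribbon_tensor (J : pred nat) a p (x : tpow k n p) : Prop :=
  supported J a (cf x) /\ forall m, annihilated (fun s => cf x (m :: s)).

Lemma sum_neq0_ex (I : finType) (P : pred I) (F : I -> k) :
  \sum_(i | P i) F i != 0 -> exists2 i, P i & F i != 0.
Proof.
move=> nz; case: (pselect (exists2 i, P i & F i != 0)) => // no.
case/eqP: nz; rewrite big1 // => i Pi; apply/eqP/negPn/negP => Fi.
by case: no; exists i.
Qed.

Lemma fuse_supported (J J' : pred nat) d a p (x : tpow k n p.+2) :
  (forall j, J j -> J' (j + d)%N) ->
  supported J (d :: a) (cf x) -> supported J' a (cf (fuse x : tpow k n p.+1)).
Proof.
move=> JJ' sx m s; rewrite cf_fuse => /sum_neq0_ex[kk /eqP mE /sx[Jk [dk <-]]].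
by rewrite [in J' _]mE mdegD dk; split=> //; apply: JJ'.
Qed.

(** The first adjacent product after fusing is the first one after fusing the
    second and third factors, by associativity; the others come from the
    products that kill x already. *)
Lemma fuse_annihilated p (x : tpow k n p.+2) :
  (forall m, annihilated (fun s => cf x (m :: s))) ->
  annihilated (cf (fuse x : tpow k n p.+1)).
Proof.
move=> ax [|m0 pre] m suf.
  case: p x ax => [|p] x ax; first by rewrite big1.
  rewrite -[LHS](cf_fuse (fuse x : tpow k n p.+2) m suf) fuse_assoc.
  have -> : tens_map idfun (@fuse k n (tpow k n p)) x = 0 :> tpow k n p.+2.
    apply: cf_eq0 => -[|m0 [|m1 s]] //=.
    have := ax m0 [::] m1 s; rewrite -[LHS](cf_fuse (slice m0 x : tpow k n p.+2)) /=.
    by rewrite slice_map.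
  by rewrite fuse0 cf0.
rewrite [LHS](eq_bigr _ (fun kk _ => cf_fuse x m0 _)) exchange_big /= big1 // => kk' _.
exact: (ax (bmnm kk'.1) (bmnm kk'.2 :: pre)).
Qed.

Lemma fuse0_annihilated p (x : tpow k n p.+2) :
  (forall m, annihilated (fun s => cf x (m :: s))) ->
  fuse x = 0 -> annihilated (cf x).
Proof.
move=> ax x0 [|m0 pre] m suf; last exact: ax.
by rewrite -[LHS](cf_fuse x m suf) x0 cf0.
Qed.

Lemma slice_lmulX (N : lmodType k) m (z : tensor S N) m0 :
  slice m0 (lmul 'X_[m] z) = if (m <= m0)%MM then slice (m0 - m)%MM z else 0.
Proof.
elim/tens_ind: z => [|a y u IH]; first by rewrite lmul0 !slice0 if_same.
rewrite lmulD !sliceD {}IH lmulE !sliceE mulrC.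
case: ifP => [le|nle]; first by rewrite -{1}(submK le) addmC mcoeffMX.
rewrite addr0 mcoeffM big1 ?scale0r // => kk /eqP e.
rewrite mcoeffX; case: eqP => [me|]; last by rewrite mulr0.
by rewrite e me lem_addl in nle.
Qed.

Lemma lmulX_leading a p (m m' : mon) s (y : tpow k n p.+1) :
  leading a m' s y -> leading a (m + m')%MM s (lmul 'X_[m] y : tpow k n p.+1).
Proof.
move=> [y1 y2]; split=> [|m0 s0] /=; rewrite slice_lmulX.
  by rewrite lem_addr addmC addmK.
case: ifP => [le /(y2 (m0 - m)%MM s0)[[<- <-]|]|_]; [left|by right|by rewrite cf0 eqxx].
by rewrite addmC submK.
Qed.

End FuseRibbon.

Section Embedding.
Variables (k : comNzRingType) (n d : nat).
Local Notation S := {mpoly k[n]}.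
Local Notation mon := 'X_{1..n}.
Local Notation R := (veronese k n d).

Fact veronese_val_linear : linear (@veronese_val k n d).
Proof. by []. Qed.

HB.instance Definition _ := GRing.isLinear.Build k _ _ _ (@veronese_val k n d)
  veronese_val_linear.

Section Ribbon.
Variable a : seq nat.
Local Notation N := (schur k n (ribbon a)).

Definition schur_tpow (y : N) : tpow k n (size a) := tcast (size a) (schur_val y).

Fact schur_tpow_linear : linear schur_tpow.
Proof. by move=> c x y; rewrite /schur_tpow linearP. Qed.

HB.instance Definition _ := GRing.isLinear.Build k _ _ _ schur_tpow
  schur_tpow_linear.

Definition embed : tensor R N -> tpow k n (size a).+1 :=
  tens_map (@veronese_val k n d) schur_tpow.

Fact embed_linear : linear embed.
Proof. exact: tens_map_linear. Qed.

HB.instance Definition _ := GRing.isLinear.Build k _ _ _ embed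
  embed_linear.

Lemma embed0 : embed 0 = 0. Proof. exact: linear0. Qed.
Lemma embedD x y : embed (x + y) = embed x + embed y.
Proof. exact: linearD. Qed.

Lemma embedE b y : embed (tens b y) = tens (veronese_val b) (schur_tpow y).
Proof. exact: tens_mapE. Qed.

Lemma embed_scale (b : R) (x : base_change R N) :
  embed (b *: x) = lmul (veronese_val b) (embed x).
Proof.
elim/tens_ind: x => [|c y u IH].
  by rewrite -[LHS]/(embed (bc_scale b 0)) bc_scale0 !embed0 lmul0.
rewrite -[LHS]/(embed (bc_scale b (tens c y + u))) bc_scaleDr !embedD.
by rewrite lmulD -IH bc_scale_tens !embedE lmulE.
Qed.

Lemma gl_schur_tpow g (y : N) :
  schur_tpow (gl_schur g y) = gl_tpow g (size a) (schur_tpow y).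
Proof. by rewrite /schur_tpow gl_tcast. Qed.

Lemma gl_embed g (x : base_change R N) :
  embed (gl_bc g x) = gl_tpow g (size a).+1 (embed x).
Proof.
rewrite /gl_bc gl_tpowS; elim/tens_ind: x => [|b y u IH].
  by rewrite tens_map0 !embed0 tens_map0.
rewrite tens_mapD !embedD tens_mapD IH; congr (_ + _).
by rewrite !(tens_mapE, embedE) gl_schur_tpow.
Qed.

End Ribbon.

Section PositiveRibbon.
Variable a : seq nat.
Hypotheses (pa : positive a) (a0 : (0 < size a)%N).
Local Notation N := (schur k n (ribbon a)).

Lemma cf_schur_tpow (y : N) s : cf (schur_tpow y) s = cf (schur_val y) s.
Proof. by rewrite /schur_tpow cf_tcast // schur_ribbon_size. Qed.

Lemma schur_tpow_inj (y : N) : schur_tpow y = 0 -> y = 0.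
Proof.
move=> y0; apply: val_inj; apply: cf_eq0 => s.
by rewrite -[LHS]cf_schur_tpow y0 cf0.
Qed.

Lemma schur_tpow_ribbon (y : N) : ribbon_vector a (schur_tpow y).
Proof.
have := schur_ribbon_vector pa (schur_valP y).
by rewrite /ribbon_vector; have -> : cf (schur_tpow y) = cf (schur_val y) by
  apply/funext => s; apply: cf_schur_tpow.
Qed.

Lemma schur_tpow_image (x : tpow k n (size a)) :
  ribbon_vector a x -> exists y : N, schur_tpow y = x.
Proof.
move=> hx; pose x' : tpow k n (size (diag_rows (ribbon a))) := tcast _ x.
have : ribbon_vector a x'.
  move: hx; rewrite /ribbon_vector; suff -> : cf x' = cf x by [].
  by apply/funext => s; rewrite cf_tcast // schur_ribbon_size.
move/(ribbon_vector_schur pa a0) => hx'; exists (Defs.Schur hx').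
by rewrite /schur_tpow /= tcastK // schur_ribbon_size.
Qed.

(** Grading by the degree of the ring coefficient only; allowing a set of degrees
    covers both single degrees and the whole module. *)
Definition graded_by (J : pred nat) (u : tensor R N) : Prop :=
  lspan (fun z => exists (b : R) (y : N),
    (exists2 e, J e & veronese_val b \is e.-homog) /\ z = tens b y) u.

Lemma embed_annihilated (u : tensor R N) m :
  annihilated (fun s => cf (embed u) (m :: s)).
Proof.
elim/tens_ind: u => [|q y u IH] pre m1 suf.
  by rewrite embed0 big1 // => kk _; rewrite cf0.
under eq_bigr => kk _ do rewrite embedD cfD embedE cf_tens.
rewrite big_split /= -big_distrr /= [X in _ * X](schur_tpow_ribbon y).2 mulr0.
by rewrite [X in _ + X]IH addr0.
Qed.

Lemma embed_tens_supported (J : pred nat) (q : R) (y : N) :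
  (forall m, m \in msupp (veronese_val q) -> J (mdeg m)) ->
  supported J a (cf (embed (tens q y))).
Proof.
move=> hq m s; rewrite embedE cf_tens.
case: (boolP (m \in msupp (veronese_val q))) => [mq|/memN_msupp_eq0 ->]; last first.
  by rewrite mul0r eqxx.
case: (eqVneq (cf (schur_tpow y) s) 0) => [->|nz _]; first by rewrite mulr0 eqxx.
by split; [apply: hq | apply: (schur_tpow_ribbon y).1].
Qed.

Lemma embed_supported (u : tensor R N) :
  supported (fun j => d %| j)%N a (cf (embed u)).
Proof.
elim/tens_ind: u => [|q y u IH]; first by move=> m s; rewrite embed0 cf0 eqxx.
rewrite embedD -[embed (tens q y)]scale1r; apply: supportedZD => //.
apply: embed_tens_supported => m.
by move/(deg_inP _ _ (veronese_valP q)) => /=; rewrite mod0n.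
Qed.

Lemma embed_graded (J : pred nat) (u : tensor R N) :
  graded_by J u -> supported J a (cf (embed u)).
Proof.
elim=> [|c0 _ v [q [y [[e Je hq] ->]]] _ IH].
  by move=> m s; rewrite embed0 cf0 eqxx.
rewrite linearP; apply: supportedZD => //.
by apply: embed_tens_supported => m /(dhomog_mf hq) /= ->.
Qed.

(** Slicing along the first factor reduces to the description of the Schur
    functor itself. *)
Lemma embed_image (J : pred nat) (x : tpow k n (size a).+1) :
  (forall j, J j -> d %| j)%N -> tail_ribbon_tensor J a x ->
  exists u : tensor R N, graded_by J u /\ embed u = x.
Proof.
move=> Jd [sx ax]; have [b0 /(_ b0 (leqnn b0)) ->] := slice_dec x.
elim/big_ind: _ => [|x1 x2 [u1 [g1 <-]] [u2 [g2 <-]]|m _].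
- by exists 0; split; [left | rewrite embed0].
- by exists (u1 + u2); rewrite embedD -[u1]scale1r; split=> //; apply: lspanD.
have [y yx] : exists y : N, schur_tpow y = slice m x.
  apply: schur_tpow_image; split=> [s /(sx (bmnm m) s) [_ ->] //|]; exact: ax.
case: (boolP (J (mdeg m))) => [Jm|nJ]; last first.
  have -> : slice m x = 0.
    apply: (@cf_eq0 k n (size a)) => s; apply/eqP; apply/negPn/negP => /(sx (bmnm m) s)[Jm _].
    by rewrite Jm in nJ.
  exists 0; split; first by left.
  by rewrite embed0 tens0r.
have hX : ('X_[m] : S) \in veronese_pred d.
  by apply/deg_inP => m'; rewrite msuppX mem_seq1 => /eqP -> /=; rewrite mod0n; apply: Jd.
exists (tens (Veronese hX) y); rewrite embedE yx; split=> //.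
apply: lspan_gen; exists (Veronese hX), y; split=> //.
by exists (mdeg m); rewrite ?dhomogX.
Qed.

(** Reduces questions on coordinates over R to coordinates over k, one monomial
    at a time. *)
Lemma slice_embed_coords q (e : 'I_q -> N) (z : 'I_q -> R) m :
  slice m (embed (\sum_l z l *: bc_basis R e l : base_change R N)) =
    schur_tpow (\sum_l (veronese_val (z l))@_m *: e l).
Proof.
elim/big_ind2: _ => [|x1 x2 y1 y2 h1 h2|l _].
- by rewrite embed0 slice0 linear0.
- by rewrite embedD sliceD h1 h2 linearD.
- by rewrite bc_scaleE mulr1 embedE sliceE linearZ.
Qed.

Lemma embed_coords_eq0 q (e : 'I_q -> N) (z : 'I_q -> R) m : is_basis e ->
  slice m (embed (\sum_l z l *: bc_basis R e l : base_change R N)) = 0 ->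
  forall l, (veronese_val (z l))@_m = 0.
Proof.
move=> be; rewrite slice_embed_coords => /schur_tpow_inj z0 l.
have [c0 [_ u]] := be 0.
have e1 : c0 = 0.
  by apply: u; rewrite big1 // => j _; rewrite ffunE scale0r.
have e2 : c0 = [ffun l => (veronese_val (z l))@_m].
  apply: u; rewrite -[LHS]z0; apply: eq_bigr => j _.
  by rewrite ffunE.
by have := congr1 (fun f : {ffun _ -> k} => f l) e2; rewrite e1 !ffunE.
Qed.

Lemma embed_inj (u v : base_change R N) : embed u = embed v -> u = v.
Proof.
move=> uv; apply/eqP; rewrite -subr_eq0; apply/eqP.
have : embed (u - v) = 0 by rewrite linearB /= uv subrr.
move: (u - v) => w w0.
have [q [e be]] := schur_basis k n pa a0.
have [z [wE _]] := bc_basisP (A := R) be w.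
rewrite wE big1 // => l _; suff -> : z l = 0 by rewrite scale0r.
apply: val_inj; apply/mpolyP => m; rewrite mcoeff0.
by apply: (embed_coords_eq0 be); rewrite -wE w0 slice0.
Qed.

End PositiveRibbon.

(** The exactness statement: the sorted splitting of the first monomial turns
    the leading elements of the Schur functor of the longer ribbon into leading
    elements of the module of x. *)
Lemma ribbon_lift (J : pred nat) c b (x : tpow k n (size b).+1) :
  positive (c :: b) ->
  (forall (m : mon) s, J (mdeg m) -> map mdeg s = b -> path (@desc n) m s ->
     (c <= mdeg m)%N && (d %| mdeg m - c)%N) ->
  ribbon_tensor J b x ->
  exists u : tensor R (schur k n (ribbon (c :: b))), fuse (embed u) = x.
Proof.
move=> pa HJ; move: x; apply: ribbon_generation => //.
- by exists 0; rewrite embed0 fuse0.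
- move=> c0 _ _ [u1 <-] [u2 <-]; exists (c0 *: u1 + u2).
  by rewrite !linearP.
move=> m s Jm ds pms; have /andP[cm dmc] := HJ m s Jm ds pms.
have [m1 [m2 [mE dm1 nd]]] := sorted_split (leq_subr c (mdeg m)).
have dm2 : mdeg m2 = c.
  have := congr1 mdeg mE; rewrite mdegD dm1 => e.
  by apply/eqP; rewrite -(eqn_add2l (mdeg m - c)) -e subnK.
have pm2 : path (@desc n) m2 s.
  case: s pms {ds} => [//|m' s] /= /andP[/descP[i [j [ji mi mj]]] ->].
  rewrite andbT; case/andP: pa => c0 _.
  have [i2 mi2] : exists i2 : 'I_n, (0 < m2 i2)%N.
    apply/existsP; apply: contraLR c0; rewrite negb_exists -leqNgt -dm2 => /forallP no.
    by rewrite mdegE big1 // => i' _; have := no i'; case: (m2 i').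
  apply/descP; case: (leqP i i2) => [le|lt].
    by exists i2, j; split=> //; apply: leq_trans le.
  exists i, j; split=> //; move: mi; rewrite mE mnmDE addn_gt0 => /orP[mi1|//].
  by case/descP: nd; exists i, i2.
have [|y ly] := schur_leading k (a := c :: b) (m := m2) (s := s) _ pa pm2.
  by rewrite /= dm2 ds.
have hX : ('X_[m1] : S) \in veronese_pred d.
  by apply/deg_inP => m'; rewrite msuppX mem_seq1 => /eqP -> /=; rewrite mod0n dm1.
pose u : tensor R (schur k n (ribbon (c :: b))) := tens (Veronese hX) y.
exists (fuse (embed u)); split; first by exists u.
  split; last by apply: fuse_annihilated => m'; apply: (embed_annihilated pa).
  have su : supported (pred1 (mdeg m - c)%N) (c :: b) (cf (embed u)).
    apply: (embed_tens_supported pa) => m'.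
    by rewrite /= msuppX mem_seq1 => /eqP ->; rewrite /= dm1.
  apply: (@fuse_supported k n _ J c b (size b) (embed u) _ su).
  by move=> j /eqP ->; rewrite subnK.
rewrite embedE fuseE mE; apply: lmulX_leading.
case: ly => l1 l2.
by split=> [|m' s']; rewrite (@cf_schur_tpow (c :: b) pa); [apply: l1 | apply: l2].
Qed.

End Embedding.

(** * The differentials and exactness *)

Section Resolution.
Variables (k : comNzRingType) (n d : nat).
Local Notation S := {mpoly k[n]}.
Local Notation mon := 'X_{1..n}.
Local Notation R := (veronese k n d).
Local Notation F a := (base_change R (schur k n (ribbon a))).

(** The maps of the resolution are obtained by showing that fusing preserves the
    images of the embeddings. *)
Lemma lift_linear (A : nzRingType) (U V : lmodType A) (T : Type)
    (f : U -> T) (g : V -> T) :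
  injective g -> (forall u, exists v, g v = f u) ->
  (forall c u u' v v', g v = f u -> g v' = f u' -> g (c *: v + v') = f (c *: u + u')) ->
  exists h : {linear U -> V}, forall u, g (h u) = f u.
Proof.
move=> gi /choice[h hP] H.
have hl : linear h by move=> c u v; apply: gi; rewrite hP; symmetry; apply: H.
pose L := GRing.isLinear.Build A U V _ h hl.
by exists (HB.pack h L : {linear U -> V}).
Qed.

Lemma fuse_fuse_embed c e b (u : F (c :: e :: b)) : positive (c :: e :: b) ->
  fuse (fuse (embed u)) = 0.
Proof.
move=> pa; apply: (@cf_eq0 k n (size b).+1) => -[//|m s].
have ax := @fuse_annihilated k n (size b).+1 (embed u) (embed_annihilated pa u).
rewrite [LHS](@cf_fuse k n (size b) (fuse (embed u))).
exact: (ax [::]).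
Qed.

Lemma differential_exists a : positive (d :: a) -> (0 < size a)%N ->
  exists del : {linear F (d :: a) -> F a},
    forall u, embed (del u) = fuse (embed u).
Proof.
move=> pa a0; have pa' : positive a by case/andP: pa.
apply: (@lift_linear R (F (d :: a)) (F a) _ (fun u => fuse (embed u)) (@embed k n d a)).
- exact: embed_inj.
- move=> u; have [||v [_ vE]] := @embed_image k n d a pa' a0 (fun j => d %| j)%N
    (fuse (embed u)); last by exists v.
  + by [].
  + split; last first.
      by move=> m pre; apply: (fuse_annihilated (embed_annihilated pa u) (m :: pre)).
    apply: (@fuse_supported k n (fun j => d %| j)%N _ d a _ (embed u)).
      by move=> j dj; rewrite dvdn_addr.
    exact: embed_supported.
move=> c u u' v v' e e'; rewrite !embedD !embed_scale e e'.
by rewrite [RHS]fuseD fuse_lmul.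
Qed.

(** A descent at the first place forces the first monomial to be nontrivial, and
    the degree of this monomial, a multiple of d, is then at least d. *)
Lemma kernel_lift c b (u : F (c :: b)) : (0 < d)%N -> positive (c :: b) ->
  fuse (embed u) = 0 ->
  exists w : F (d :: c :: b), fuse (embed w) = embed u.
Proof.
move=> d0 pa u0; apply: (ribbon_lift (J := fun j => d %| j)%N).
- by rewrite /= d0.
- move=> m s dm ds pms; have md : (d <= mdeg m)%N.
    apply: dvdn_leq => //; case: s ds pms => [//|m' s] _ /= /andP[/descP[i [j [_ mi _]]] _].
    by rewrite mdegE (bigD1 i) //= addn_gt0 mi.
  by rewrite md dvdn_sub.
split; first exact: embed_supported.
exact: (@fuse0_annihilated k n _ (embed u) (embed_annihilated pa u) u0).
Qed.

Section Module.
Variable r : nat.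
Local Notation M := (veronese_mod k n r d).

(** M as the case of no further factor; the factor k is the empty tensor
    power. *)
Definition mod_tpow (x : M) : tpow k n 1 := tens (veronese_mod_val x) (1 : k^o).

Lemma cf_mod_tpow x m : cf (mod_tpow x) [:: m] = (veronese_mod_val x)@_m.
Proof. by rewrite /mod_tpow (@cf_tens k n 0) /= mulr1. Qed.

Lemma mod_tpow_inj : injective mod_tpow.
Proof.
move=> x y xy; apply: val_inj; apply/mpolyP => m.
by rewrite /= -!cf_mod_tpow xy.
Qed.

Lemma mod_tpow_lin (a : R) x y :
  mod_tpow (a *: x + y) = lmul (veronese_val a) (mod_tpow x) + mod_tpow y.
Proof. by rewrite /mod_tpow lmulE -tensDl. Qed.

Lemma mod_tpow_gl g x :
  mod_tpow (gl_veronese_mod g x) = gl_tpow g 1 (mod_tpow x).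
Proof. by rewrite gl_tpowS tens_mapE. Qed.

Lemma mod_tpow_supported x :
  supported (fun j => (r <= j) && (j == r %[mod d]))%N [::] (cf (mod_tpow x)).
Proof.
move=> m s nz; have := cf_size nz; case: s nz => [|//] nz _; split=> //.
move: nz; rewrite cf_mod_tpow -mcoeff_msupp.
exact: (deg_inP _ _ (veronese_mod_valP x)).
Qed.

Lemma mod_tpow_image (x : tpow k n 1) :
  supported (fun j => (r <= j) && (j == r %[mod d]))%N [::] (cf x) ->
  exists y, mod_tpow y = x.
Proof.
move=> sx; have [b0 /(_ b0 (leqnn b0)) xE] := slice_dec x.
pose p : S := \sum_(m : 'X_{1..n < b0}) (slice m x : k) *: 'X_[m].
have pP : p \in veronese_mod_pred r d.
  apply: rpred_sum => m _; case: (eqVneq (slice m x : k) 0) => [->|nz].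
    by rewrite scale0r rpred0.
  apply: rpredZ; apply/deg_inP => m'; rewrite msuppX mem_seq1 => /eqP ->.
  by have [] := sx (bmnm m) [::] nz.
exists (VeroneseMod pP); rewrite /mod_tpow /= [RHS]xE /p.
elim/big_ind2: _ => [|p1 t1 p2 t2 e1 e2|m _].
- by rewrite tens0l.
- by rewrite tensDl e1 e2.
by rewrite tensZl -tensZr /GRing.scale /= mulr1.
Qed.

Lemma augmentation_exists : (0 < r)%N ->
  exists eps : {linear F [:: r] -> M},
    forall u, mod_tpow (eps u) = fuse (embed u).
Proof.
move=> r0; have pr : positive [:: r] by rewrite /= r0.
apply: (@lift_linear R (F [:: r]) M _ (fun u => fuse (embed u)) mod_tpow).
- exact: mod_tpow_inj.
- move=> u; apply: mod_tpow_image.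
  apply: (@fuse_supported k n (fun j => d %| j)%N _ r [::] 0 (embed u)).
    by move=> j dj; rewrite leq_addl -[X in _ == X %[mod _]]add0n eqn_modDr mod0n.
  exact: embed_supported.
move=> c u u' v v' e e'; rewrite mod_tpow_lin e e' embedD embed_scale.
by rewrite [RHS]fuseD fuse_lmul.
Qed.

(** The case of a single monomial in [ribbon_lift]: the descent condition is
    empty, and a monomial of M splits into one of R and one of degree r. *)
Lemma augmentation_lift (x : M) : (0 < r)%N ->
  exists u : F [:: r], fuse (embed u) = mod_tpow x.
Proof.
move=> r0; apply: (ribbon_lift (J := fun j => (r <= j) && (j == r %[mod d]))%N).
- by rewrite /= r0.
- by move=> m s /andP[rm /eqP rE] _ _; rewrite rm -eqn_mod_dvd // rE eqxx.
split; first exact: mod_tpow_supported.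
move=> pre m suf; rewrite big1 // => kk _; apply/eqP; apply/negPn/negP => /cf_size.
by rewrite size_cat /= !addnS.
Qed.

End Module.

End Resolution.

(** * Degrees and minimality *)

Section Degrees.
Variables (k : comNzRingType) (n d : nat).
Local Notation S := {mpoly k[n]}.
Local Notation mon := 'X_{1..n}.
Local Notation R := (veronese k n d).
Local Notation F a := (base_change R (schur k n (ribbon a))).

Lemma lspan_mono (A : nzRingType) (V : lmodType A) (G G' : V -> Prop) x :
  (forall z, G z -> G' z) -> lspan G x -> lspan G' x.
Proof.
by move=> GG'; elim=> [|c u v Gu _ IH]; [left | right => //; apply: GG'].
Qed.

Lemma bc_homogP a j (u : F a) :
  bc_homog j u <-> graded_by (fun e => e + sumn a == j)%N u.
Proof.
split; apply: lspan_mono => z.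
  move=> [e [b [y [ej hb ->]]]]; exists b, y; split=> //.
  by exists e => //; rewrite -ej card_ribbon.
by move=> [b [y [[e /eqP ej hb] ->]]]; exists e, b, y; rewrite card_ribbon.
Qed.

Lemma augmentation_homog r j (u : F [:: r]) (x : veronese_mod k n r d) :
  (0 < r)%N -> mod_tpow x = fuse (embed u) -> bc_homog j u ->
  veronese_mod_val x \is j.-homog.
Proof.
move=> r0 xu /bc_homogP gu; have pr : positive [:: r] by rewrite /= r0.
have := @fuse_supported k n _ (pred1 j) r [::] 0 (embed u) _ (embed_graded pr gu).
move=> H; apply/dhomogP => m; rewrite mcoeff_msupp -cf_mod_tpow xu => nz.
have [] := H _ m [::] nz; last by move/eqP.
by move=> e; rewrite /= addn0.
Qed.

Lemma differential_homog a j (u : F (d :: a)) (v : F a) :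
  positive (d :: a) -> (0 < size a)%N -> embed v = fuse (embed u) ->
  bc_homog j u -> bc_homog j v.
Proof.
move=> pa a0 vu /bc_homogP gu; have pa' : positive a by case/andP: pa.
have [||w [gw wv]] := @embed_image k n d a pa' a0
  (fun e => (d %| e) && (e + sumn a == j))%N (embed v).
- by move=> e /andP[].
- split; last exact: embed_annihilated.
  move=> m s nz; have [dm sa] := embed_supported pa' nz; split=> //; rewrite dm /=.
  rewrite vu in nz.
  suff /(_ m s nz)[] : supported (fun e => e + sumn a == j)%N a
    (cf (fuse (embed u) : tpow k n (size a).+1)) by [].
  apply: (@fuse_supported k n _ _ d a _ (embed u) _ (embed_graded pa gu)).
  by move=> e; rewrite /= addnA.
apply/bc_homogP; rewrite -(embed_inj pa' a0 wv).
apply: lspan_mono gw => z [b [y [[e /andP[_ ej] hb] ->]]].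
by exists b, y; split=> //; exists e.
Qed.

(** A basis element has coefficient 1, of degree 0, so after fusing it lies in
    S^d (x) S^D(V), and its coordinates are homogeneous of degree d. *)
Lemma differential_entries a q (e : 'I_q -> schur k n (ribbon a))
    (y : schur k n (ribbon (d :: a))) (z : 'I_q -> R) :
  positive (d :: a) -> is_basis e ->
  embed (\sum_l z l *: bc_basis R e l : F a) =
    fuse (embed (tens (1 : R) y)) ->
  forall l, veronese_val (z l) \in veronese_mod_pred d d.
Proof.
move=> pa be zy l; have pa' : positive a by case/andP: pa.
apply/deg_inP => m; rewrite mcoeff_msupp => nz.
suff -> : mdeg m = d by rewrite /= leqnn eqxx.
apply/eqP; apply: contraR nz => md; apply/eqP; move: l; apply: (embed_coords_eq0 pa' be).
rewrite zy; apply: (@cf_eq0 k n (size a)) => s; apply/eqP; apply: contraR md.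
have s1 : supported (pred1 0%N) (d :: a) (cf (embed (tens (1 : R) y))).
  apply: (embed_tens_supported pa) => m'.
  by rewrite /= msupp1 mem_seq1 => /eqP ->; rewrite /= mdeg0.
have := @fuse_supported k n _ (pred1 d) d a (size a) _ _ s1 m s.
by move=> H nz; have [] := H _ nz; first by move=> j /eqP ->; rewrite /= add0n.
Qed.

End Degrees.

Theorem theorem1p1 (k : comNzRingType) (n d r : nat)
    (hd : (0 < d)%N) (hr : (0 < r)%N) :
  let R := veronese k n d in
  let M := veronese_mod k n r d in
  let D (i : nat) := ribbon (rcons (nseq i d) r) in
  let F (i : nat) : lmodType R := base_change R (schur k n (D i)) in
  exists (eps : {linear F 0%N -> M})
         (del : forall i : nat, {linear F i.+1 -> F i}),
    (* exactness at M, F 0, and F i.+1 *)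
    [/\ (forall x : M, exists u : F 0%N, eps u = x),
        (forall u : F 0%N, eps u = 0 <-> exists w : F 1%N, del 0%N w = u)
      & (forall (i : nat) (u : F i.+1),
           del i u = 0 <-> exists w : F i.+2, del i.+1 w = u)] /\
    (* GL(V)-equivariance *)
    (forall g h : 'M[k]_n, g *m h = 1%:M -> h *m g = 1%:M ->
       (forall u : F 0%N, eps (gl_bc g u) = gl_veronese_mod g (eps u)) /\
       (forall (i : nat) (u : F i.+1), del i (gl_bc g u) = gl_bc g (del i u))) /\
    (* the maps preserve degrees *)
    ((forall (j : nat) (u : F 0%N),
        bc_homog j u -> veronese_mod_val (eps u) \is j.-homog) /\
     (forall (i j : nat) (u : F i.+1), bc_homog j u -> bc_homog j (del i u))) /\
    (* R-bases in degree d i + r, with respect to which the matrices of the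
       differentials have all their entries in R_+ = S^(>= d, d) *)
    (exists (m : nat -> nat) (b : forall i : nat, 'I_(m i) -> F i),
       [/\ (forall i : nat, is_basis (b i)),
           (forall (i : nat) (l : 'I_(m i)), bc_homog (d * i + r) (b i l))
         & (forall i : nat, exists A : 'M[R]_(m i.+1, m i),
              (forall j, del i (b i.+1 j) = \sum_l A j l *: b i l) /\
              (forall j l, veronese_val (A j l) \in veronese_mod_pred d d))]).
Proof.
move=> R M D F; pose a i := rcons (nseq i d) r.
have pa i : positive (a i).
  by rewrite /a all_rcons hr; apply/allP => j /nseqP[-> _].
have a0 i : (0 < size (a i))%N by rewrite size_rcons.
have [eps epsE] := augmentation_exists k n d hr.
pose del i := sval (cid (differential_exists k n (pa i.+1) (a0 i))).
have delE i (u : F i.+1) : embed (del i u) = fuse (embed u).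
  by rewrite /del; case: (cid _) => h hE /=; apply: hE.
have inj i : injective (@embed k n d (a i)) by move=> u v; apply: embed_inj.
have eps0 : mod_tpow (0 : M) = 0.
  apply: (@cf_eq0 k n 1) => -[|m [|m' s]] //.
  by rewrite cf_mod_tpow mcoeff0.
exists eps, del; split; last split; last split.
- split=> [x|u|i u].
  + have [u ux] := augmentation_lift x hr.
    by exists u; apply: mod_tpow_inj; rewrite epsE.
  + split=> [u0|[w <-]]; last first.
      apply: mod_tpow_inj; rewrite eps0 epsE [X in fuse X](delE 0%N w).
      exact: (fuse_fuse_embed w (pa 1%N)).
    have [|w wu] := kernel_lift hd (pa 0%N : positive [:: r]) (u := u).
      by rewrite -epsE u0 eps0.
    by exists w; apply: (inj 0%N); apply: etrans (delE 0%N w) wu.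
  + split=> [u0|[w <-]]; last first.
      apply: inj; rewrite embed0 delE [X in fuse X](delE i.+1 w).
      exact: (fuse_fuse_embed w (pa i.+2)).
    have [|w wu] := kernel_lift hd (pa i.+1 : positive (d :: a i)) (u := u).
      by apply: etrans (esym (delE i u)) _; rewrite u0 embed0.
    by exists w; apply: (inj i.+1); apply: etrans (delE i.+1 w) wu.
- move=> g _ _ _; split=> [u|i u].
    by apply: mod_tpow_inj; rewrite mod_tpow_gl !epsE gl_embed gl_fuse.
  by apply: inj; rewrite delE !gl_embed delE gl_fuse.
- split=> [j u hu|i j u hu]; first exact: augmentation_homog hr (epsE u) hu.
  exact: differential_homog (pa i.+1) (a0 i) (delE i u) hu.
pose p i := cid (schur_basis k n (pa i) (a0 i)).
pose m i := sval (p i).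
pose e i : 'I_(m i) -> schur k n (D i) := sval (cid (svalP (p i))).
have eP i : is_basis (e i) := svalP (cid (svalP (p i))).
have bP i : is_basis (bc_basis R (e i)) := bc_basisP (A := R) (eP i).
exists m, (fun i => bc_basis R (e i)); split=> // [i l|i].
  apply/bc_homogP; apply: lspan_gen; exists 1, (e i l); split=> //.
  exists 0%N; last exact: dhomog1.
  by rewrite add0n sumn_rcons sumn_nseq.
have /choice[c cE] j : exists c : {ffun 'I_(m i) -> R},
    del i (bc_basis R (e i.+1) j) = \sum_l c l *: bc_basis R (e i) l.
  by have [c [cE _]] := bP i (del i (bc_basis R (e i.+1) j)); exists c.
exists (\matrix_(j, l) c j l); split=> [j|j l].
  by rewrite cE; apply: eq_bigr => l _; rewrite mxE.
rewrite mxE; move: l.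
by apply: (differential_entries (pa i.+1) (eP i)); rewrite -cE; apply: delE.
Qed.
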